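(* Let $G$ be a finitely generated nilpotent group with $Z(G)\le Is(G')$, and let $H$ be a finitely generated group with $H\equiv G$. Then $G\cong H$.
   Context: $Is(G')=\{x\in G:\ x^k\in G' \text{ for some integer } k\ge1\}$ is the isolator of the commutator subgroup $G'$; $Z(G)$ is the center; $\equiv$ is elementary equivalence in the language of groups. *)

(* Defs.v *)
From Stdlib Require Import List Arith.



Record Group : Type := {
  carrier :> Type;
  gmul : carrier -> carrier -> carrier;
  ginv : carrier -> carrier;
  gone : carrier;
  gmul_assoc : forall x y z, gmul x (gmul y z) = gmul (gmul x y) z;
  gmul_one_l : forall x, gmul gone x = x;
  gmul_one_r : forall x, gmul x gone = x;
  gmul_inv_l : forall x, gmul (ginv x) x = gone;
  gmul_inv_r : forall x, gmul x (ginv x) = gone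
}.

Section GroupDefs.
Variable G : Group.

Inductive gen (S : G -> Prop) : G -> Prop :=
  | gen_in : forall x, S x -> gen S x
  | gen_one : gen S (gone G)
  | gen_mul : forall x y, gen S x -> gen S y -> gen S (gmul G x y)
  | gen_inv : forall x, gen S x -> gen S (ginv G x).

Definition comm (x y : G) : G :=
  gmul G (gmul G (ginv G x) (ginv G y)) (gmul G x y).

Definition comm_with_G (A : G -> Prop) : G -> Prop :=
  gen (fun z => exists a g, A a /\ z = comm a g).

Fixpoint lcs (n : nat) : G -> Prop :=
  match n with
  | 0 => fun _ => True
  | S m => comm_with_G (lcs m)
  end.

Definition derived : G -> Prop := lcs 1.

Definition nilpotent : Prop :=
  exists n, forall x, lcs n x -> x = gone G.

Definition center : G -> Prop :=
  fun x => forall y, gmul G x y = gmul G y x.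

Fixpoint gpow (x : G) (k : nat) : G :=
  match k with 0 => gone G | S m => gmul G x (gpow x m) end.

Definition isolator (A : G -> Prop) : G -> Prop :=
  fun x => exists k, 1 <= k /\ A (gpow x k).

Definition fin_gen : Prop :=
  exists l : list G, forall x, gen (fun y => In y l) x.

End GroupDefs.

Definition group_iso (G H : Group) : Prop :=
  exists (f : G -> H) (g : H -> G),
    (forall x y, f (gmul G x y) = gmul H (f x) (f y)) /\
    (forall x, g (f x) = x) /\ (forall y, f (g y) = y).

Inductive term : Type :=
  | tvar : nat -> term
  | tone : term
  | tmul : term -> term -> term
  | tinv : term -> term.

Inductive formula : Type :=
  | fbot : formula
  | feq : term -> term -> formula
  | fnot : formula -> formula
  | fand : formula -> formula -> formula
  | for_ : formula -> formula -> formula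
  | fimp : formula -> formula -> formula
  | fall : nat -> formula -> formula
  | fex : nat -> formula -> formula.

Fixpoint teval (G : Group) (e : nat -> G) (t : term) : G :=
  match t with
  | tvar n => e n
  | tone => gone G
  | tmul a b => gmul G (teval G e a) (teval G e b)
  | tinv a => ginv G (teval G e a)
  end.

Definition upd (G : Group) (e : nat -> G) (n : nat) (a : G) : nat -> G :=
  fun m => if Nat.eqb m n then a else e m.

Fixpoint sat (G : Group) (e : nat -> G) (f : formula) : Prop :=
  match f with
  | fbot => False
  | feq a b => teval G e a = teval G e b
  | fnot p => ~ sat G e p
  | fand p q => sat G e p /\ sat G e q
  | for_ p q => sat G e p \/ sat G e q
  | fimp p q => sat G e p -> sat G e q
  | fall n p => forall a : G, sat G (upd G e n a) p
  | fex n p => exists a : G, sat G (upd G e n a) p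
  end.

Fixpoint tfv (t : term) : list nat :=
  match t with
  | tvar n => n :: nil
  | tone => nil
  | tmul a b => tfv a ++ tfv b
  | tinv a => tfv a
  end.

Fixpoint ffv (f : formula) : list nat :=
  match f with
  | fbot => nil
  | feq a b => tfv a ++ tfv b
  | fnot p => ffv p
  | fand p q | for_ p q | fimp p q => ffv p ++ ffv q
  | fall n p | fex n p => filter (fun m => negb (Nat.eqb m n)) (ffv p)
  end.

Definition sentence (f : formula) : Prop := ffv f = nil.

(* G ⊨ φ for a sentence φ (value independent of the environment) *)
Definition models (G : Group) (f : formula) : Prop :=
  forall e : nat -> G, sat G e f.

Definition elem_equiv (G H : Group) : Prop :=
  forall f, sentence f -> (models G f <-> models H f).

(* Main.v *)
Require Import Defs.
From Stdlib Require Import List Arith ZArith Lia Wf_nat.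
From Stdlib Require Import Classical ClassicalEpsilon FunctionalExtensionality PropExtensionality.
Import ListNotations.

(** Let Z_i be the upper central series. For a bilinear map such as the commutator map
    L x G -> G/Z_i, with L = Z_{i+2}/Z_{i+1}, the endomorphisms m of L such that every
    [m(-), g] is again some [-, u] form a ring, and its center R is a commutative ring which is
    finitely generated as an additive group. A scalar is determined by the tuple of the u's for
    generators g of G, so R and its action on L are definable. Each scalar of H is a root of a
    monic integer polynomial, and finitely many of them span the scalars of H. In G, the module L
    has a finite filtration with cyclic factors R a whose annihilators are prime, so each of these
    polynomials has only finitely many roots modulo the annihilator of a. A formula listing the
    values of these roots on a as words in the generators of G therefore forces, in H, that
    Z_{i+2} is contained in X Z_{i+1}, where X is generated by the tuple satisfying the formula.

    It follows that H = X Z(H). Since Z(G)^k is contained in G' for some k, every element of Z(G)^k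
    is a product of boundedly many commutators with the generators, and Z(G)/Z(G)^k is finite; these
    two facts transfer and give Z(H) <= X, so X = H. As G is finitely presented, this yields an
    epimorphism G -> H. By symmetry there is an epimorphism H -> G, and G is Hopfian. *)

(** * Groups, powers and generated subgroups *)

(** Two obstacles shape the argument. Finite generation of a ring or a module is not a first-order
    property, and a tuple of H that satisfies the formula of a generating tuple of G is not known to
    generate H. What a formula can say is that given integer polynomials have finitely many root
    values at a module element and that these values are given words. The polynomials are therefore
    chosen in H, where the scalars are integral, and their roots are listed afterwards in G: the
    sentence depends on both groups, and elementary equivalence allows this. Consequences of
    generation on which the encoding relies (non-degeneracy tested on the tuple alone, adjoint
    elements for every g) are written into the formula, so that they hold in H as well.

    Scalars are the center of the ring of adjointable maps because bounding the number of roots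
    requires commutativity. The pairing with G is trivial on Z_1, so the method stops at Z_1, and
    the hypothesis on the isolator has to take over there. *)

Arguments gmul {_} _ _.
Arguments ginv {_} _.
Arguments gone {_}.
Arguments comm {_} _ _.
Arguments gpow {_} _ _.
Arguments gen {_} _ _.

Declare Scope grp_scope.
Delimit Scope grp_scope with grp.
Infix "*" := gmul : grp_scope.
Notation "x ^-1" := (ginv x) (at level 3, left associativity, format "x ^-1") : grp_scope.
Notation "1" := gone : grp_scope.
Local Open Scope grp_scope.

Section Basics.
Variable G : Group.
Implicit Types x y z : G.

Lemma mulA x y z : (x * y) * z = x * (y * z).
Proof. now rewrite gmul_assoc. Qed.
Lemma mul1g x : 1 * x = x. Proof. apply gmul_one_l. Qed.
Lemma mulg1 x : x * 1 = x. Proof. apply gmul_one_r. Qed.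
Lemma mulVg x : x^-1 * x = 1. Proof. apply gmul_inv_l. Qed.
Lemma mulgV x : x * x^-1 = 1. Proof. apply gmul_inv_r. Qed.
Lemma mulKg x y : x^-1 * (x * y) = y.
Proof. now rewrite gmul_assoc, mulVg, mul1g. Qed.
Lemma mulKVg x y : x * (x^-1 * y) = y.
Proof. now rewrite gmul_assoc, mulgV, mul1g. Qed.
Lemma mul_cancel_l x y z : x * y = x * z -> y = z.
Proof. intro E. rewrite <- (mulKg x y), E. apply mulKg. Qed.
Lemma inv_uniq x y : x * y = 1 -> y = x^-1.
Proof. intro E. apply (mul_cancel_l x). now rewrite E, mulgV. Qed.
Lemma invK x : (x^-1)^-1 = x.
Proof. symmetry. apply inv_uniq, mulVg. Qed.
Lemma inv1 : (1:G)^-1 = 1.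
Proof. symmetry. apply inv_uniq, mul1g. Qed.
Lemma invM x y : (x * y)^-1 = y^-1 * x^-1.
Proof. symmetry. apply inv_uniq. now rewrite mulA, mulKVg, mulgV. Qed.
End Basics.

Hint Rewrite mulA mul1g mulg1 mulVg mulgV mulKg mulKVg invK inv1 invM : grp.
(* These rules are a complete rewriting system for free groups, so this decides word identities. *)
Ltac word := intros; unfold comm; autorewrite with grp; try reflexivity.

Section Powers.
Variable G : Group.
Implicit Types x y z : G.

Definition zpow x (k : Z) : G :=
  match k with
  | Z0 => 1
  | Zpos p => gpow x (Pos.to_nat p)
  | Zneg p => (gpow x (Pos.to_nat p))^-1
  end.

Lemma gpowSr x n : gpow x (S n) = gpow x n * x.
Proof.
  induction n; simpl in *; [word|]. rewrite IHn at 1. word.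
Qed.

Lemma zpow_nat x n : zpow x (Z.of_nat n) = gpow x n.
Proof.
  destruct n; [reflexivity|]. simpl Z.of_nat. unfold zpow.
  now rewrite SuccNat2Pos.id_succ.
Qed.

Lemma zpow_opp x k : zpow x (- k) = (zpow x k)^-1.
Proof. destruct k; simpl; word. Qed.

Lemma zpow_succ x k : zpow x (Z.succ k) = zpow x k * x.
Proof.
  destruct (Z_le_gt_dec 0 k) as [H|H].
  - replace k with (Z.of_nat (Z.to_nat k)) by lia. rewrite <- Nat2Z.inj_succ, !zpow_nat.
    apply gpowSr.
  - destruct (Z.to_nat (- k)) as [|m] eqn:E; [lia|].
    replace (Z.succ k) with (- Z.of_nat m)%Z by lia.
    replace k with (- Z.of_nat (S m))%Z by lia.
    rewrite !zpow_opp, !zpow_nat. simpl. word.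
Qed.

Lemma zpow_pred x k : zpow x (Z.pred k) = zpow x k * x^-1.
Proof.
  replace k with (Z.succ (Z.pred k)) at 2 by lia. rewrite zpow_succ. word.
Qed.

Lemma zpow_add x k l : zpow x (k + l) = zpow x k * zpow x l.
Proof.
  induction l using Z.peano_ind.
  - rewrite Z.add_0_r. simpl. word.
  - rewrite Z.add_succ_r, !zpow_succ, IHl. word.
  - rewrite Z.add_pred_r, !zpow_pred, IHl. word.
Qed.

Lemma zpow_1 x : zpow x 1%Z = x.
Proof. unfold zpow. simpl. word. Qed.

Lemma zpow_mul x k l : zpow x (k * l) = zpow (zpow x k) l.
Proof.
  induction l using Z.peano_ind.
  - rewrite Z.mul_0_r. reflexivity.
  - rewrite Z.mul_succ_r, zpow_add, zpow_succ, IHl. reflexivity.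
  - rewrite Z.mul_pred_r, zpow_pred. unfold Z.sub. now rewrite zpow_add, zpow_opp, IHl.
Qed.

Lemma zpow_commute x y k : x * y = y * x -> zpow x k * y = y * zpow x k.
Proof.
  intro E. induction k using Z.peano_ind.
  - simpl. word.
  - rewrite zpow_succ, mulA, E, gmul_assoc, IHk. word.
  - rewrite zpow_pred.
    assert (E' : x^-1 * y = y * x^-1).
    { apply (mul_cancel_l _ x). rewrite mulKVg, <- mulA, E. word. }
    rewrite mulA, E', gmul_assoc, IHk. word.
Qed.

Lemma zpow_mul_commute x y k : x * y = y * x -> zpow (x * y) k = zpow x k * zpow y k.
Proof.
  intro E. induction k using Z.peano_ind.
  - simpl. word.
  - rewrite !zpow_succ, IHk, !mulA. f_equal. rewrite !gmul_assoc. f_equal.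
    rewrite (zpow_commute y x); auto.
  - rewrite !zpow_pred, IHk, !mulA. f_equal. rewrite E, invM, !gmul_assoc. f_equal.
    symmetry. apply (mul_cancel_l _ x). rewrite !mulKVg. rewrite gmul_assoc.
    rewrite <- (zpow_commute y x) by auto. word.
Qed.

End Powers.
Arguments zpow {G} x k.

Section Subgroups.
Variable G : Group.

Definition subgroup (P : G -> Prop) : Prop :=
  P 1 /\ (forall x y, P x -> P y -> P (x * y)) /\ (forall x, P x -> P (x^-1)).

Definition genl (l : list G) : G -> Prop := gen (fun y => In y l).

Definition fg_sub (P : G -> Prop) : Prop :=
  exists l, forall x, P x <-> genl l x.

(** Relative to a subset, because it is also applied to the scalars inside the group of all maps L
    -> L, which need not be Noetherian itself. *)
Definition noeth_on (S : G -> Prop) : Prop :=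
  forall P, subgroup P -> (forall x, P x -> S x) -> fg_sub P.

Lemma gen_subgroup S : subgroup (gen S).
Proof. repeat split; [apply gen_one | apply gen_mul | apply gen_inv]. Qed.

Lemma gen_min (S P : G -> Prop) : subgroup P -> (forall x, S x -> P x) ->
  forall x, gen S x -> P x.
Proof. intros (H1 & H2 & H3) HS x Hx. induction Hx; auto. Qed.

Lemma gen_mono (S S' : G -> Prop) : (forall x, S x -> S' x) -> forall x, gen S x -> gen S' x.
Proof. intros H. apply gen_min; [apply gen_subgroup | intros; apply gen_in; auto]. Qed.

Lemma subgroup_zpow P x k : subgroup P -> P x -> P (zpow x k).
Proof.
  intros (H1 & H2 & H3) Hx. induction k using Z.peano_ind; [exact H1 | |].
  - rewrite zpow_succ. auto.
  - rewrite zpow_pred. auto.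
Qed.

Lemma gen_zpow (S : G -> Prop) (x : G) k : gen S x -> gen S (zpow x k).
Proof. intros Hx. exact (subgroup_zpow (gen S) x k (gen_subgroup S) Hx). Qed.

Lemma subgroup_ldiv P x y : subgroup P -> P x -> P (x * y) -> P y.
Proof. intros (H1 & H2 & H3) Hx Hxy. rewrite <- (mulKg _ x y). auto. Qed.

Lemma subgroup_rdiv P x y : subgroup P -> P y -> P (x * y) -> P x.
Proof.
  intros (H1 & H2 & H3) Hx Hxy. replace x with (x * y * y^-1) by word. auto.
Qed.

Lemma gen_norm (S : G -> Prop) (c : G) :
  (forall s, S s -> gen S (c * (s * c^-1)) /\ gen S (c^-1 * (s * c))) ->
  forall k p, gen S p -> gen S (zpow c k * p * zpow c (- k)).
Proof.
  intros HS.
  assert (Hn1 : forall p, gen S p -> gen S (c * (p * c^-1))).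
  { intros p Hp. induction Hp.
    - now apply HS.
    - replace (c * (1 * c^-1)) with (1:G) by word. apply gen_one.
    - replace (c * (x * y * c^-1)) with ((c * (x * c^-1)) * (c * (y * c^-1))) by word.
      now apply gen_mul.
    - replace (c * (x^-1 * c^-1)) with ((c * (x * c^-1))^-1) by word. now apply gen_inv. }
  assert (Hn2 : forall p, gen S p -> gen S (c^-1 * (p * c))).
  { intros p Hp. induction Hp.
    - now apply HS.
    - replace (c^-1 * (1 * c)) with (1:G) by word. apply gen_one.
    - replace (c^-1 * (x * y * c)) with ((c^-1 * (x * c)) * (c^-1 * (y * c))) by word.
      now apply gen_mul.
    - replace (c^-1 * (x^-1 * c)) with ((c^-1 * (x * c))^-1) by word. now apply gen_inv. }
  assert (Hn' : forall k p, gen S p -> gen S (zpow c (- k) * p * zpow c k)).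
  { intros k. induction k using Z.peano_ind; intros p Hp.
    - simpl. now replace (1 * p * 1) with p by word.
    - rewrite zpow_opp, zpow_succ.
      replace ((zpow c k * c)^-1 * p * (zpow c k * c))
        with (c^-1 * (((zpow c k)^-1 * p * zpow c k) * c)) by word.
      apply Hn2. rewrite <- zpow_opp. now apply IHk.
    - rewrite zpow_opp, zpow_pred.
      replace ((zpow c k * c^-1)^-1 * p * (zpow c k * c^-1))
        with (c * (((zpow c k)^-1 * p * zpow c k) * c^-1)) by word.
      apply Hn1. rewrite <- zpow_opp. now apply IHk. }
  intros k p Hp. pose proof (Hn' (- k)%Z p Hp) as H. now rewrite Z.opp_involutive in H.
Qed.

(** Since c normalizes the subgroup generated by S, all its powers can be collected on the left. *)
Lemma gen_cyc (S : G -> Prop) (c : G) :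
  (forall s, S s -> gen S (c * (s * c^-1)) /\ gen S (c^-1 * (s * c))) ->
  forall x, gen (fun y => c = y \/ S y) x ->
  exists k p, gen S p /\ x = zpow c k * p.
Proof.
  intros HS. pose proof (gen_norm S c HS) as Hn.
  intros x Hx. induction Hx as [x Hx| |x y _ (k & p & Hp & ->) _ (l & q & Hq & ->)
                               |x _ (k & p & Hp & ->)].
  - destruct Hx as [<-|Hx].
    + exists 1%Z, 1. split; [apply gen_one|]. rewrite zpow_1. word.
    + exists 0%Z, x. split; [now apply gen_in|]. simpl. word.
  - exists 0%Z, 1. split; [apply gen_one|]. simpl. word.
  - exists (k + l)%Z, (zpow c (- l) * p * zpow c (- - l) * q). split.
    + apply gen_mul; auto.
    + rewrite zpow_add, !zpow_opp. word.
  - exists (- k)%Z, (zpow c k * p^-1 * zpow c (- k)). split.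
    + apply Hn. now apply gen_inv.
    + rewrite zpow_opp. word.
Qed.

End Subgroups.
Arguments subgroup {G} P.
Arguments genl {G} l.
Arguments fg_sub {G} P.
Arguments noeth_on {G} S.
Notation noeth G := (@noeth_on G (fun _ => True)).

Lemma Zsubgroup_cyclic (P : Z -> Prop) :
  P 0%Z -> (forall k l, P k -> P l -> P (k - l)%Z) ->
  exists d, P d /\ forall k, P k -> exists m, k = (d * m)%Z.
Proof.
  intros H0 Hs.
  assert (Hopp : forall k, P k -> P (- k)%Z).
  { intros k Hk. replace (- k)%Z with (0 - k)%Z by lia. auto. }
  assert (Hadd : forall k l, P k -> P l -> P (k + l)%Z).
  { intros k l Hk Hl. replace (k + l)%Z with (k - - l)%Z by lia. auto. }
  assert (Hmul : forall m k, P k -> P (k * m)%Z).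
  { intros m k Hk. induction m using Z.peano_ind.
    - now rewrite Z.mul_0_r.
    - rewrite Z.mul_succ_r. auto.
    - rewrite Z.mul_pred_r. auto. }
  (* The generator is the least positive element, by Euclidean division, or 0 for the trivial
     subgroup. *)
  destruct (classic (exists n, n <> 0 /\ P (Z.of_nat n))) as [Hex|Hno].
  - destruct (dec_inh_nat_subset_has_unique_least_element
                (fun n => n <> 0 /\ P (Z.of_nat n))) as (d & (Hd & Hmin) & _); auto.
    { intro n. apply classic. }
    destruct Hd as [Hd0 HPd].
    exists (Z.of_nat d). split; auto. intros k Hk. exists (k / Z.of_nat d)%Z.
    destruct (Nat.eq_dec (Z.to_nat (k mod Z.of_nat d)) 0) as [E|E].
    + pose proof (Z.div_mod k (Z.of_nat d)). pose proof (Z.mod_pos_bound k (Z.of_nat d)). lia.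
    + exfalso.
      pose proof (Z.div_mod k (Z.of_nat d)). pose proof (Z.mod_pos_bound k (Z.of_nat d)).
      assert (d <= Z.to_nat (k mod Z.of_nat d)); [|lia].
      apply Hmin. split; auto. rewrite Z2Nat.id by lia.
      replace (k mod Z.of_nat d)%Z with (k - Z.of_nat d * (k / Z.of_nat d))%Z by lia. auto.
  - exists 0%Z. split; auto. intros k Hk. exists 0%Z.
    destruct (Z.eq_dec k 0) as [E|E]; [lia|]. exfalso. apply Hno.
    exists (Z.to_nat (Z.abs k)). split; [lia|]. rewrite Z2Nat.id by lia.
    destruct (Z.abs_eq_or_opp k) as [->| ->]; auto.
Qed.

(** * Definable predicates *)

Fixpoint tmax (t : term) : nat :=
  match t with
  | tvar n => n
  | tone => 0
  | tmul a b => Nat.max (tmax a) (tmax b)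
  | tinv a => tmax a
  end.

Fixpoint fmax (f : formula) : nat :=
  match f with
  | fbot => 0
  | feq a b => Nat.max (tmax a) (tmax b)
  | fnot p => fmax p
  | fand p q | for_ p q | fimp p q => Nat.max (fmax p) (fmax q)
  | fall n p | fex n p => Nat.max n (fmax p)
  end.

Fixpoint trename (r : nat -> nat) (t : term) : term :=
  match t with
  | tvar n => tvar (r n)
  | tone => tone
  | tmul a b => tmul (trename r a) (trename r b)
  | tinv a => tinv (trename r a)
  end.

Fixpoint frename (r : nat -> nat) (f : formula) : formula :=
  match f with
  | fbot => fbot
  | feq a b => feq (trename r a) (trename r b)
  | fnot p => fnot (frename r p)
  | fand p q => fand (frename r p) (frename r q)
  | for_ p q => for_ (frename r p) (frename r q)
  | fimp p q => fimp (frename r p) (frename r q)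
  | fall n p => fall (r n) (frename r p)
  | fex n p => fex (r n) (frename r p)
  end.

Lemma teval_rename (G : Group) e r t :
  teval G e (trename r t) = teval G (fun n => e (r n)) t.
Proof. induction t; simpl; congruence. Qed.

Lemma teval_agree (G : Group) e e' t :
  (forall n, In n (tfv t) -> e n = e' n) -> teval G e t = teval G e' t.
Proof.
  induction t; simpl; intros H; auto.
  - rewrite IHt1, IHt2; auto; intros; apply H, in_or_app; auto.
  - rewrite IHt; auto.
Qed.

Lemma upd_rename (G : Group) e (r : nat -> nat) n (a : G) :
  (forall i j, r i = r j -> i = j) ->
  (fun m => upd G e (r n) a (r m)) = upd G (fun m => e (r m)) n a.
Proof.
  intros Hr. extensionality m. unfold upd.
  destruct (Nat.eqb_spec (r m) (r n)), (Nat.eqb_spec m n); subst; auto.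
  - apply Hr in e0. congruence.
  - congruence.
Qed.

(** Bound variables are renamed by the same map, so injectivity is what excludes capture. *)
Lemma sat_rename (G : Group) r f : (forall i j, r i = r j -> i = j) ->
  forall e, sat G e (frename r f) <-> sat G (fun n => e (r n)) f.
Proof.
  intros Hr. induction f; simpl; intros e; try (rewrite IHf1, IHf2; tauto);
    try (rewrite IHf; tauto); try tauto.
  - now rewrite !teval_rename.
  - split; intros H a; specialize (H a).
    + rewrite IHf, upd_rename in H; auto.
    + rewrite IHf, upd_rename; auto.
  - split; intros [a H]; exists a.
    + rewrite IHf, upd_rename in H; auto.
    + rewrite IHf, upd_rename; auto.
Qed.

Lemma in_ffv_quant n m (l : list nat) :
  In m l -> m <> n -> In m (filter (fun m => negb (Nat.eqb m n)) l).
Proof.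
  intros. apply filter_In. split; auto. destruct (Nat.eqb_spec m n); simpl; congruence.
Qed.

Lemma sat_agree (G : Group) f : forall e e',
  (forall n, In n (ffv f) -> e n = e' n) -> sat G e f <-> sat G e' f.
Proof.
  assert (Hu : forall p n (e e' : nat -> G) a,
    (forall m, In m (filter (fun m => negb (Nat.eqb m n)) (ffv p)) -> e m = e' m) ->
    forall m, In m (ffv p) -> upd G e n a m = upd G e' n a m).
  { intros p n e e' a H m Hm. unfold upd. destruct (Nat.eqb_spec m n); auto.
    apply H, in_ffv_quant; auto. }
  induction f; simpl; intros e e' H; try tauto.
  - rewrite (teval_agree G e e' t), (teval_agree G e e' t0); try tauto;
      intros; apply H, in_or_app; auto.
  - rewrite (IHf e e'); tauto.
  - rewrite (IHf1 e e'), (IHf2 e e'); [tauto| |]; intros; apply H, in_or_app; auto.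
  - rewrite (IHf1 e e'), (IHf2 e e'); [tauto| |]; intros; apply H, in_or_app; auto.
  - rewrite (IHf1 e e'), (IHf2 e e'); [tauto| |]; intros; apply H, in_or_app; auto.
  - split; intros Hs a; specialize (Hs a);
      now apply (IHf (upd G e n a) (upd G e' n a) (Hu _ _ _ _ _ H)).
  - split; intros [a Hs]; exists a;
      now apply (IHf (upd G e n a) (upd G e' n a) (Hu _ _ _ _ _ H)).
Qed.

Lemma tfv_le t n : In n (tfv t) -> n <= tmax t.
Proof.
  induction t; simpl; intros H; try tauto.
  - destruct H; [lia | tauto].
  - apply in_app_or in H. destruct H as [H|H]; [apply IHt1 in H | apply IHt2 in H]; lia.
Qed.

Lemma ffv_le f n : In n (ffv f) -> n <= fmax f.
Proof.
  induction f; simpl; intros H; try tauto;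
    try (apply in_app_or in H; destruct H as [H|H];
         [apply IHf1 in H | apply IHf2 in H]; lia).
  - apply in_app_or in H. destruct H as [H|H]; apply tfv_le in H; lia.
  - apply filter_In in H. destruct H as [H _]. apply IHf in H. lia.
  - apply filter_In in H. destruct H as [H _]. apply IHf in H. lia.
Qed.

Definition scons {T : Type} (a : T) (e : nat -> T) : nat -> T :=
  fun m => match m with 0 => a | S i => e i end.

Definition is_term (X : forall G : Group, (nat -> G) -> G) : Prop :=
  exists t, forall G e, teval G e t = X G e.

(** The predicate takes the group as an argument so that one formula serves all groups; this
    uniformity is what lets a property pass from G to H. Closure rules then replace the writing of
    explicit formulas. *)
Definition definable (P : forall G : Group, (nat -> G) -> Prop) : Prop :=
  exists f, forall G e, sat G e f <-> P G e.

Lemma is_term_var k : is_term (fun G e => e k).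
Proof. now exists (tvar k). Qed.
Lemma is_term_teval t : is_term (fun G e => teval G e t).
Proof. now exists t. Qed.
Lemma is_term_one : is_term (fun G e => 1).
Proof. now exists tone. Qed.
Lemma is_term_mul X Y : is_term X -> is_term Y -> is_term (fun G e => X G e * Y G e).
Proof. intros [t Ht] [u Hu]. exists (tmul t u). intros. simpl. congruence. Qed.
Lemma is_term_inv X : is_term X -> is_term (fun G e => (X G e)^-1).
Proof. intros [t Ht]. exists (tinv t). intros. simpl. congruence. Qed.
Lemma is_term_sub X s : is_term X -> is_term (fun G e => X G (fun i => e (s i))).
Proof. intros [t Ht]. exists (trename s t). intros. now rewrite teval_rename, Ht. Qed.
Lemma is_term_comm X Y : is_term X -> is_term Y -> is_term (fun G e => comm (X G e) (Y G e)).
Proof.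
  intros HX HY. apply is_term_mul; apply is_term_mul; auto; now apply is_term_inv.
Qed.
Lemma is_term_gpow X k : is_term X -> is_term (fun G e => gpow (X G e) k).
Proof. intros HX. induction k; [apply is_term_one | now apply (is_term_mul X)]. Qed.
Lemma is_term_zpow X k : is_term X -> is_term (fun G e => zpow (X G e) k).
Proof.
  intros HX. destruct k; [apply is_term_one | now apply is_term_gpow |].
  now apply is_term_inv, is_term_gpow.
Qed.

Lemma definable_ext P Q : (forall G e, P G e <-> Q G e) -> definable P -> definable Q.
Proof. intros H [f Hf]. exists f. intros. now rewrite Hf. Qed.
Lemma definable_eq X Y : is_term X -> is_term Y -> definable (fun G e => X G e = Y G e).
Proof. intros [t Ht] [u Hu]. exists (feq t u). intros. simpl. now rewrite Ht, Hu. Qed.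
Lemma definable_and P Q : definable P -> definable Q -> definable (fun G e => P G e /\ Q G e).
Proof. intros [f Hf] [g Hg]. exists (fand f g). intros. simpl. now rewrite Hf, Hg. Qed.
Lemma definable_or P Q : definable P -> definable Q -> definable (fun G e => P G e \/ Q G e).
Proof. intros [f Hf] [g Hg]. exists (for_ f g). intros. simpl. now rewrite Hf, Hg. Qed.
Lemma definable_imp P Q : definable P -> definable Q -> definable (fun G e => P G e -> Q G e).
Proof. intros [f Hf] [g Hg]. exists (fimp f g). intros. simpl. now rewrite Hf, Hg. Qed.
Lemma definable_not P : definable P -> definable (fun G e => ~ P G e).
Proof. intros [f Hf]. exists (fnot f). intros. simpl. now rewrite Hf. Qed.
Lemma definable_False : definable (fun G e => False).
Proof. exists fbot. simpl. tauto. Qed.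
Lemma definable_True : definable (fun G e => True).
Proof. exists (fnot fbot). simpl. tauto. Qed.

Lemma definable_forall_in {T} (l : list T) (P : forall G : Group, (nat -> G) -> T -> Prop) :
  (forall t, definable (fun G e => P G e t)) -> definable (fun G e => forall t, In t l -> P G e t).
Proof.
  intros H. induction l as [|t l IH].
  - apply (definable_ext (fun G e => True)); [|apply definable_True]. intros. simpl. tauto.
  - apply (definable_ext (fun G e => P G e t /\ forall u, In u l -> P G e u)).
    + intros. simpl. split; [intros [? ?] u [<-|?]; auto | auto].
    + now apply definable_and.
Qed.

Lemma definable_exists_in {T} (l : list T) (P : forall G : Group, (nat -> G) -> T -> Prop) :
  (forall t, definable (fun G e => P G e t)) -> definable (fun G e => exists t, In t l /\ P G e t).
Proof.
  intros H. induction l as [|t l IH].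
  - apply (definable_ext (fun G e => False)); [|apply definable_False]. intros. simpl. firstorder.
  - apply (definable_ext (fun G e => P G e t \/ exists u, In u l /\ P G e u)).
    + intros. simpl. split; [intros [?|(u & ? & ?)]; eauto | intros (u & [<-|?] & ?); eauto].
    + now apply definable_or.
Qed.

Lemma definable_lt n (P : forall G : Group, (nat -> G) -> nat -> Prop) :
  (forall j, definable (fun G e => P G e j)) -> definable (fun G e => forall j, j < n -> P G e j).
Proof.
  intros H. apply (definable_ext (fun G e => forall j, In j (seq 0 n) -> P G e j)).
  - intros. split; intros HP j Hj; apply HP; [apply in_seq; lia | apply in_seq in Hj; lia].
  - now apply definable_forall_in.
Qed.

(* Variables are renamed along the cycle 0 -> K -> K-1 -> ... -> 0, where [K] bounds
   all variables of the formula; quantifying over [K] then binds the old variable 0. *)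
Lemma definable_scons_all P : definable P -> definable (fun G e => forall a, P G (scons a e)).
Proof.
  intros [f Hf]. set (K := fmax f).
  set (r := fun m => if Nat.eqb m 0 then K else if Nat.leb m K then m - 1 else m).
  assert (Hr : forall i j, r i = r j -> i = j).
  { intros i j. unfold r.
    destruct (Nat.eqb_spec i 0), (Nat.eqb_spec j 0), (Nat.leb_spec i K), (Nat.leb_spec j K); lia. }
  exists (fall K (frename r f)). intros G e. simpl.
  assert (Ha : forall a, sat G (upd G e K a) (frename r f) <-> P G (scons a e)).
  { intros a. rewrite sat_rename by auto. rewrite <- Hf. apply sat_agree.
    intros n Hn. apply ffv_le in Hn. fold K in Hn. unfold upd, r, scons.
    destruct n as [|n].
    - cbn [Nat.eqb]. now rewrite Nat.eqb_refl.
    - destruct (Nat.leb_spec (S n) K); [|lia]. cbn [Nat.eqb].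
      destruct (Nat.eqb_spec (S n - 1) K); [lia|]. f_equal. lia. }
  split; intros H a; now apply Ha.
Qed.

Lemma definable_scons_ex P : definable P -> definable (fun G e => exists a, P G (scons a e)).
Proof.
  intros HP. apply (definable_ext (fun G e => ~ forall a, ~ P G (scons a e))).
  - intros G e. split; [apply not_all_not_ex | intros [a Ha] H; now apply (H a)].
  - apply definable_not, (definable_scons_all (fun G e => ~ P G e)), definable_not, HP.
Qed.

Lemma definable_all (Q : forall G : Group, (nat -> G) -> G -> Prop) :
  definable (fun G e => Q G (fun i => e (S i)) (e 0)) -> definable (fun G e => forall a, Q G e a).
Proof. intros H. apply (definable_scons_all _ H). Qed.

Lemma definable_ex (Q : forall G : Group, (nat -> G) -> G -> Prop) :
  definable (fun G e => Q G (fun i => e (S i)) (e 0)) -> definable (fun G e => exists a, Q G e a).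
Proof. intros H. apply (definable_scons_ex _ H). Qed.

Definition splice {T : Type} (n : nat) (v e : nat -> T) : nat -> T :=
  fun m => if Nat.ltb m n then v m else e (m - n).

Lemma splice_S {T} n (v e : nat -> T) :
  splice (S n) v e = scons (v 0) (splice n (fun i => v (S i)) e).
Proof. extensionality m. destruct m; reflexivity. Qed.

Lemma definable_appn_all n : forall P, definable P -> definable (fun G e => forall v, P G (splice n v e)).
Proof.
  induction n; intros P HP.
  - apply (definable_ext P); auto. intros G e.
    assert (E : forall v, splice 0 v e = e).
    { intro v. extensionality m. unfold splice. simpl. f_equal. lia. }
    split; [intros H v; now rewrite E | intros H; rewrite <- (E e); auto].
  - apply (definable_ext (fun G e => forall v a, P G (scons a (splice n v e)))).
    + intros G e. split; intros H v; [rewrite splice_S; auto|]. intros a.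
      specialize (H (scons a v)). rewrite splice_S in H. exact H.
    + apply (IHn (fun G e => forall a, P G (scons a e))). now apply definable_scons_all.
Qed.

(** Tuples are infinite sequences of which only the first n entries matter. Under this condition a
    quantifier over sequences amounts to n first-order quantifiers. *)
Definition local {T : Type} (n : nat) (P : (nat -> T) -> Prop) : Prop :=
  forall v w, (forall j, j < n -> v j = w j) -> P v -> P w.

Lemma definable_allt n (Q : forall G : Group, (nat -> G) -> (nat -> G) -> Prop) :
  (forall G e, local n (Q G e)) ->
  definable (fun G e => Q G (fun i => e (n + i)) (fun j => e j)) ->
  definable (fun G e => forall v, Q G e v).
Proof.
  intros HQ H. apply (definable_appn_all n) in H. revert H. apply definable_ext. intros G e.
  assert (E : forall v : nat -> G, (fun i => splice n v e (n + i)) = e).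
  { intros v. extensionality i. unfold splice. destruct (Nat.ltb_spec (n + i) n); [lia|].
    f_equal. lia. }
  assert (E' : forall (v : nat -> G) j, j < n -> splice n v e j = v j).
  { intros v j Hj. unfold splice. destruct (Nat.ltb_spec j n); [auto | lia]. }
  split; intros H v; specialize (H v); rewrite ?E in *; revert H; apply HQ;
    intros j Hj; rewrite E'; auto.
Qed.

Lemma definable_ext_t n (Q : forall G : Group, (nat -> G) -> (nat -> G) -> Prop) :
  (forall G e, local n (Q G e)) ->
  definable (fun G e => Q G (fun i => e (n + i)) (fun j => e j)) ->
  definable (fun G e => exists v, Q G e v).
Proof.
  intros HQ H. apply (definable_ext (fun G e => ~ forall v, ~ Q G e v)).
  - intros G e. split; [apply not_all_not_ex | intros [a Ha] H'; now apply (H' a)].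
  - apply definable_not, (definable_allt n (fun G e v => ~ Q G e v)).
    + intros G e v w E Hv Hw. apply Hv. revert Hw. apply HQ. intros. symmetry. auto.
    + now apply definable_not.
Qed.

(** * Transfer of existential statements *)

Definition fexs (l : list nat) (f : formula) : formula := fold_right fex f l.

Lemma ffv_fexs l f n : In n (ffv (fexs l f)) -> In n (ffv f) /\ ~ In n l.
Proof.
  induction l as [|k l IH]; simpl; intros H; [tauto|].
  apply filter_In in H. destruct H as [H E]. apply IH in H.
  destruct (Nat.eqb_spec n k); simpl in E; [discriminate|].
  destruct H as [H1 H2]. split; auto. intros [<-|?]; auto.
Qed.

Lemma sat_fexs (G : Group) l f : forall e,
  sat G e (fexs l f) <-> exists e', (forall n, ~ In n l -> e' n = e n) /\ sat G e' f.
Proof.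
  induction l as [|k l IH]; simpl; intros e.
  - split.
    + intros H. exists e. auto.
    + intros (e' & E & H). replace e with e'; auto. extensionality n. auto.
  - split.
    + intros [a H]. apply IH in H. destruct H as (e' & E & H). exists e'. split; auto.
      intros n Hn. rewrite E by tauto. unfold upd.
      destruct (Nat.eqb_spec n k); auto. subst. tauto.
    + intros (e' & E & H). exists (e' k). apply IH. exists e'. split; auto.
      intros n Hn. unfold upd. destruct (Nat.eqb_spec n k); [now subst|]. apply E.
      intros [?|?]; auto.
Qed.

(** The existential closure of the defining formula over its free variables is a sentence, and a
    witness in G makes it true there under every environment. *)
Lemma transfer G H P : elem_equiv G H -> definable P -> (exists e, P G e) -> exists e, P H e.
Proof.
  intros EH [f Hf] [e He]. set (s := fexs (ffv f) f).
  assert (Hs : sentence s).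
  { unfold sentence. destruct (ffv s) as [|n l] eqn:E; auto.
    assert (Hn : In n (ffv s)) by (rewrite E; now left).
    apply ffv_fexs in Hn. tauto. }
  assert (HG : models G s).
  { intros e0. apply sat_fexs.
    exists (fun n => if in_dec Nat.eq_dec n (ffv f) then e n else e0 n). split.
    - intros n Hn. destruct in_dec; tauto.
    - apply (sat_agree G f e); [|now apply Hf].
      intros n Hn. destruct in_dec; tauto. }
  apply (EH s Hs) in HG. specialize (HG (fun _ => 1)).
  apply sat_fexs in HG. destruct HG as (e' & _ & H'). exists e'. now apply Hf.
Qed.

Ltac tm :=
  match goal with
  | H : is_term ?X |- is_term ?X => exact H
  | H : forall j, is_term _ |- is_term _ => solve [apply H]
  | |- is_term (fun G e => e _) => apply is_term_var
  | |- is_term (fun G e => gone) => apply is_term_one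
  | |- is_term (fun G e => comm _ _) => apply is_term_comm; tm
  | |- is_term (fun G e => gmul _ _) => apply is_term_mul; tm
  | |- is_term (fun G e => ginv _) => apply is_term_inv; tm
  | |- is_term (fun G e => zpow _ _) => apply is_term_zpow; tm
  | |- is_term (fun G e => gpow _ _) => apply is_term_gpow; tm
  | |- is_term (fun G e => teval G e _) => apply is_term_teval
  | |- is_term (fun G e => teval G (fun i => e _) _) => refine (is_term_sub _ _ (is_term_teval _))
  | H : is_term ?X |- _ => refine (is_term_sub X _ H)
  | H : forall j, is_term (fun G e => ?Y G e j) |- _ => refine (is_term_sub (fun G e => Y G e _) _ (H _))
  end.

(** * Polycyclic generating lists *)

Section Prod.
Variables G H : Group.
(** Homomorphisms out of G will be obtained as graphs, that is, as subgroups of this product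
    generated by pairs of corresponding generators. *)
Definition prodG : Group.
Proof.
  refine {| carrier := (G * H)%type;
            gmul := fun x y => (fst x * fst y, snd x * snd y);
            ginv := fun x => ((fst x)^-1, (snd x)^-1);
            gone := (1, 1) |}.
  - intros [] [] []; simpl; f_equal; apply gmul_assoc.
  - intros []; simpl; f_equal; apply mul1g.
  - intros []; simpl; f_equal; apply mulg1.
  - intros []; simpl; f_equal; apply mulVg.
  - intros []; simpl; f_equal; apply mulgV.
Defined.

Lemma zpow_prod (x : G) (y : H) k : zpow ((x, y) : prodG) k = (zpow x k, zpow y k).
Proof.
  induction k using Z.peano_ind; [reflexivity | |].
  - now rewrite !zpow_succ, IHk.
  - now rewrite !zpow_pred, IHk.
Qed.

Lemma teval_prod (e : nat -> G) (e' : nat -> H) t :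
  teval prodG (fun j => (e j, e' j)) t = (teval G e t, teval H e' t).
Proof. induction t; simpl; auto; [now rewrite IHt1, IHt2 | now rewrite IHt]. Qed.
End Prod.

Section Words.
Variable G : Group.

Definition range (e : nat -> G) (n : nat) : G -> Prop := fun y => exists j, j < n /\ y = e j.
Definition nth_env (l : list G) : nat -> G := fun i => nth i l 1.
Definition vars_lt (n : nat) (t : term) : Prop := forall i, In i (tfv t) -> i < n.

Lemma teval_gen e n t : vars_lt n t -> gen (range e n) (teval G e t).
Proof.
  unfold vars_lt. induction t; simpl; intros H.
  - apply gen_in. exists n0. auto.
  - apply gen_one.
  - apply gen_mul; [apply IHt1 | apply IHt2]; intros; apply H, in_or_app; auto.
  - apply gen_inv. auto.
Qed.

Lemma gen_teval e n x : gen (range e n) x -> exists t, vars_lt n t /\ teval G e t = x.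
Proof.
  unfold vars_lt.
  induction 1 as [x (j & Hj & ->)| |x y _ (t & Ht & <-) _ (u & Hu & <-)|x _ (t & Ht & <-)].
  - exists (tvar j). simpl. split; auto. intros i [<-|[]]; auto.
  - exists tone. simpl. tauto.
  - exists (tmul t u). simpl. split; auto. intros i Hi. apply in_app_or in Hi.
    destruct Hi; auto.
  - exists (tinv t). simpl. auto.
Qed.

Lemma genl_rng (l : list G) (x : G) : genl l x <-> gen (range (nth_env l) (length l)) x.
Proof.
  split; apply gen_mono; intros y.
  - intros Hy. apply (In_nth _ _ 1) in Hy. destruct Hy as (j & ? & ?). exists j. auto.
  - intros (j & ? & ->). now apply nth_In.
Qed.

Lemma genl_incl (l l' : list G) x : (forall y, In y l -> In y l') -> genl l x -> genl l' x.
Proof. intros H. now apply gen_mono. Qed.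

Lemma genl_sub (l : list G) P : subgroup P -> (forall y, In y l -> P y) -> forall x, genl l x -> P x.
Proof. apply gen_min. Qed.

Lemma genl_nil (x : G) : genl [] x -> x = 1.
Proof. revert x. apply gen_min; [|intros x []]. repeat split; intros; subst; word. Qed.

(** Each member normalizes the subgroup generated by the members after it, so the tails of the list
    generate a subnormal series with cyclic factors. *)
Fixpoint polycyclic (l : list G) : Prop :=
  match l with
  | [] => True
  | g :: gs => polycyclic gs /\
      forall h, In h gs -> genl gs (g * (h * g^-1)) /\ genl gs (g^-1 * (h * g))
  end.

Lemma polycyclic_noeth l : polycyclic l -> noeth_on (genl l).
Proof.
  induction l as [|g gs IH]; intros Hl P HP HPl.
  - exists []. intros x. split; intros Hx.
    + apply HPl in Hx. exact Hx.
    + apply genl_nil in Hx. subst. apply HP.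
  - destruct Hl as [Hgs Hn].
    pose proof (gen_norm _ (fun y => In y gs) g Hn) as Hnorm.
    assert (HP' := HP). destruct HP' as (P1 & PM & PI).
    destruct (IH Hgs (fun x => P x /\ genl gs x)) as [l0 Hl0].
    { repeat split; try tauto; try apply gen_one; intros.
      - apply PM; tauto.
      - apply gen_mul; tauto.
      - apply PI; tauto.
      - apply gen_inv; tauto. }
    { tauto. }
    (* The exponents of g that occur in P modulo the tail form a subgroup dZ, so a single element of
       P with exponent d, added to generators of the intersection of P with the tail, is enough. *)
    destruct (Zsubgroup_cyclic (fun k => exists p, genl gs p /\ P (zpow g k * p)))
      as (d & (p0 & Hp0 & Hd) & Hdiv).
    { exists 1. split; [apply gen_one|]. simpl. now rewrite mul1g. }
    { intros k m (p & Hp & Hk) (q & Hq & Hm).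
      exists (zpow g m * (p * q^-1) * zpow g (- m)). split.
      - apply Hnorm. apply gen_mul; auto. now apply gen_inv.
      - unfold Z.sub. rewrite zpow_add, !zpow_opp.
        replace (zpow g k * (zpow g m)^-1 * (zpow g m * (p * q^-1) * (zpow g m)^-1))
          with ((zpow g k * p) * (zpow g m * q)^-1) by word. auto. }
    assert (Hpow : forall m, exists q, genl gs q /\ zpow (zpow g d * p0) m = zpow g (d * m) * q).
    { intros m. induction m using Z.peano_ind.
      - exists 1. split; [apply gen_one|]. rewrite Z.mul_0_r. simpl. word.
      - destruct IHm as (q & Hq & E).
        exists ((zpow g (- d) * q * zpow g (- - d)) * p0). split.
        + apply gen_mul; [now apply Hnorm | auto].
        + rewrite zpow_succ, E, Z.mul_succ_r, zpow_add, !zpow_opp. word.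
      - destruct IHm as (q & Hq & E).
        exists (zpow g d * (q * p0^-1) * zpow g (- d)). split.
        + apply Hnorm. apply gen_mul; auto. now apply gen_inv.
        + rewrite zpow_pred, E, Z.mul_pred_r. unfold Z.sub. rewrite zpow_add, !zpow_opp. word. }
    exists ((zpow g d * p0) :: l0). intros x. split.
    + intros Hx. destruct (gen_cyc _ _ g Hn x (HPl x Hx)) as (k & p & Hp & ->).
      destruct (Hdiv k) as [m ->]; [eauto|].
      destruct (Hpow m) as (q & Hq & E).
      replace (zpow g (d * m) * p) with (zpow (zpow g d * p0) m * (q^-1 * p)).
      2:{ rewrite E. word. }
      apply gen_mul.
      * apply gen_zpow. apply gen_in. now left.
      * apply (genl_incl l0); [now right|]. apply Hl0. split.
        -- apply (subgroup_ldiv _ P (zpow (zpow g d * p0) m)); auto.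
           ++ now apply subgroup_zpow.
           ++ rewrite E. replace (zpow g (d * m) * q * (q^-1 * p)) with (zpow g (d * m) * p) by word.
              auto.
        -- apply gen_mul; auto. now apply gen_inv.
    + apply genl_sub; auto. intros y [<-|Hy]; auto.
      apply Hl0. now apply gen_in.
Qed.

(** A semantic form of finite presentability: Q follows, in every group, from finitely many
    relations that hold for e in G. *)
Definition forces (e : nat -> G) (Q : forall H : Group, (nat -> H) -> Prop) : Prop :=
  exists ws, (forall w, In w ws -> teval G e w = 1) /\
    forall H e', (forall w, In w ws -> teval H e' w = 1) -> Q H e'.

Lemma forces_and e Q R : forces e Q -> forces e R -> forces e (fun H e' => Q H e' /\ R H e').
Proof.
  intros (ws & H1 & H2) (ws' & H1' & H2'). exists (ws ++ ws'). split.
  - intros w Hw. apply in_app_or in Hw. destruct Hw; auto.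
  - intros H e' Hw. split; [apply H2 | apply H2']; intros; apply Hw, in_or_app; auto.
Qed.

Lemma forces_imp e (Q R : forall H : Group, (nat -> H) -> Prop) :
  (forall H e', Q H e' -> R H e') -> forces e Q -> forces e R.
Proof. intros HQR (ws & H1 & H2). exists ws. split; auto. Qed.

Lemma forces_lt e n (Q : forall H : Group, (nat -> H) -> nat -> Prop) :
  (forall j, j < n -> forces e (fun H e' => Q H e' j)) ->
  forces e (fun H e' => forall j, j < n -> Q H e' j).
Proof.
  induction n; intros HQ.
  - exists []. simpl. split; [tauto|]. intros. lia.
  - apply (forces_imp e (fun H e' => (forall j, j < n -> Q H e' j) /\ Q H e' n)).
    + intros H e' [H1 H2] j Hj. destruct (Nat.eq_dec j n); [now subst|]. apply H1. lia.
    + apply forces_and; auto.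
Qed.

Lemma forces_eq e t u : teval G e t = teval G e u ->
  forces e (fun H e' => teval H e' t = teval H e' u).
Proof.
  intros E. exists [tmul t (tinv u)]. simpl. split.
  - intros w [<-|[]]. simpl. rewrite E. word.
  - intros H e' Hw. specialize (Hw _ (or_introl eq_refl)). simpl in Hw.
    rewrite <- (invK _ (teval H e' u)). rewrite (inv_uniq _ _ _ Hw). word.
Qed.

Lemma forces_shift e g Q : forces e Q -> forces (scons g e) (fun H e' => Q H (fun i => e' (S i))).
Proof.
  intros (ws & H1 & H2). exists (map (trename S) ws). split.
  - intros w Hw. apply in_map_iff in Hw. destruct Hw as (v & <- & Hv).
    rewrite teval_rename. simpl. now apply H1.
  - intros H e' Hw. apply H2. intros w Hv. rewrite <- teval_rename.
    apply Hw. now apply in_map.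
Qed.

Lemma nthe_cons g gs : nth_env (g :: gs) = scons g (nth_env gs).
Proof. extensionality i. destruct i; reflexivity. Qed.
End Words.
Arguments range {G} e n.
Arguments nth_env {G} l.
Arguments polycyclic {G} l.
Arguments forces {G} e Q.

Definition pairing {G H : Group} (e : nat -> G) (e' : nat -> H) : nat -> prodG G H :=
  fun j => (e j, e' j).

Lemma gen_pairing {G H : Group} (e : nat -> G) (e' : nat -> H) n t :
  vars_lt n t -> gen (range (pairing e e') n) (teval G e t, teval H e' t).
Proof. intros Ht. rewrite <- teval_prod. now apply (teval_gen (prodG G H)). Qed.

(* A polycyclic presentation: the conjugation relations and the power relations of the
   cyclic factors make the subgroup generated by the pairs of generators single-valued. *)
Lemma polycyclic_presented (G : Group) (l : list G) : polycyclic l ->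
  forces (nth_env l) (fun H e' =>
    forall h, gen (range (pairing (nth_env l) e') (length l)) (1, h) -> h = 1).
Proof.
  induction l as [|g gs IH]; intros Hl.
  - exists []. split; [intros w []|]. intros H e' _ h Hh.
    assert (E : forall z, gen (range (pairing (nth_env (@nil G)) e') 0) z -> z = 1).
    { apply gen_min; [|intros z (j & ? & _); lia]. repeat split; intros; subst; word. }
    apply E in Hh. now injection Hh.
  - destruct Hl as [Hgs Hn]. specialize (IH Hgs). rewrite nthe_cons.
    set (n := length gs) in *. cbn [length]. fold n.
    assert (Hword : forall x, genl gs x -> exists t, vars_lt n t /\ teval G (nth_env gs) t = x).
    { intros x Hx. apply gen_teval. now apply genl_rng. }
    apply forces_shift with (g := g) in IH.
    assert (Hconj : forces (scons g (nth_env gs)) (fun H e' => forall j, j < n ->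
      gen (range (pairing (nth_env gs) (fun i => e' (S i))) n)
        (g * (nth_env gs j * g^-1), e' 0 * (e' (S j) * (e' 0)^-1)) /\
      gen (range (pairing (nth_env gs) (fun i => e' (S i))) n)
        (g^-1 * (nth_env gs j * g), (e' 0)^-1 * (e' (S j) * e' 0)))).
    { apply forces_lt. intros j Hj.
      destruct (Hn (nth_env gs j)) as [H1 H2]; [now apply nth_In|].
      apply Hword in H1, H2. destruct H1 as (t & Ht & Et), H2 as (u & Hu & Eu).
      apply forces_and.
      - generalize (forces_eq _ (scons g (nth_env gs)) (trename S t)
          (tmul (tvar 0) (tmul (tvar (S j)) (tinv (tvar 0))))).
        rewrite teval_rename. simpl. intros F. specialize (F Et). revert F. apply forces_imp.
        intros H e' E. rewrite teval_rename in E. rewrite <- E, <- Et. now apply gen_pairing.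
      - generalize (forces_eq _ (scons g (nth_env gs)) (trename S u)
          (tmul (tinv (tvar 0)) (tmul (tvar (S j)) (tvar 0)))).
        rewrite teval_rename. simpl. intros F. specialize (F Eu). revert F. apply forces_imp.
        intros H e' E. rewrite teval_rename in E. rewrite <- E, <- Eu. now apply gen_pairing. }
    (* Here d is the order of g modulo the tail; it is 0 when that order is infinite, and the power
       relation is then trivial. *)
    destruct (Zsubgroup_cyclic (fun k => genl gs (zpow g k))) as (d & Hd & Hdiv).
    { apply gen_one. }
    { intros k m Hk Hm. unfold Z.sub. rewrite zpow_add, zpow_opp.
      apply gen_mul; auto. now apply gen_inv. }
    destruct (Hword _ Hd) as (t & Ht & Et).
    assert (Hpow : forces (scons g (nth_env gs)) (fun H e' =>
      gen (range (pairing (nth_env gs) (fun i => e' (S i))) n) (zpow g d, zpow (e' 0) d))).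
    { destruct (is_term_zpow _ d (is_term_var 0)) as [u Hu].
      generalize (forces_eq _ (scons g (nth_env gs)) (trename S t) u).
      rewrite teval_rename, Hu. simpl. intros F. specialize (F Et). revert F. apply forces_imp.
      intros H e' E. rewrite teval_rename, Hu in E. rewrite <- E, <- Et. now apply gen_pairing. }
    revert Hpow. generalize (forces_and _ _ _ _ IH Hconj). intros F1 F2.
    generalize (forces_and _ _ _ _ F1 F2). clear F1 F2 IH Hconj. apply forces_imp.
    intros H e' ((IH & Hconj) & Hpow) h Hh.
    set (S2 := range (pairing (nth_env gs) (fun i => e' (S i))) n) in *.
    set (c := (g, e' 0) : prodG G H).
    assert (HS2 : forall s, S2 s -> gen S2 (c * (s * c^-1)) /\ gen S2 (c^-1 * (s * c))).
    { intros s (j & Hj & ->). now apply Hconj. }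
    assert (Hh' : gen (fun y => c = y \/ S2 y) ((1, h) : prodG G H)).
    { revert Hh. apply gen_mono. intros y (j & Hj & ->). destruct j as [|j].
      - now left.
      - right. exists j. split; [lia | reflexivity]. }
    (* Projecting (1, h) = c^k p to G puts g^k into the tail, so d divides k and the power relation
       moves c^k into the subgroup for the tail, where the induction hypothesis applies. *)
    destruct (gen_cyc _ S2 c HS2 _ Hh') as (k & p & Hp & E).
    apply IH. rewrite E. apply gen_mul; auto.
    assert (Hk : genl gs (zpow g k)).
    { unfold c in E. rewrite zpow_prod in E. destruct p as [p q]. simpl in E.
      injection E as E1 E2.
      assert (Hp1 : forall z, gen S2 z -> genl gs (fst z)).
      { apply gen_min.
        - repeat split; simpl; intros; [apply gen_one | now apply gen_mul | now apply gen_inv].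
        - intros z (j & Hj & ->). apply gen_in. now apply nth_In. }
      apply Hp1 in Hp. simpl in Hp.
      apply (subgroup_rdiv _ (genl gs) _ p); [apply gen_subgroup | auto |].
      rewrite <- E1. apply gen_one. }
    destruct (Hdiv _ Hk) as [m ->].
    unfold c. rewrite zpow_mul. apply gen_zpow.
    now rewrite zpow_prod.
Qed.

(** * The lower central series gives a polycyclic list *)

Section LowerCentral.
Variable G : Group.

Lemma lcs_subgroup m : subgroup (lcs G m).
Proof. destruct m; [repeat split | apply gen_subgroup]. Qed.

Lemma lcs_comm m x g : lcs G m x -> lcs G (S m) (comm x g).
Proof. intros H. apply gen_in. exists x, g. auto. Qed.

Lemma lcs_normal m x g : lcs G m x -> lcs G m (g^-1 * (x * g)).
Proof.
  revert x g. induction m as [|m IH]; [simpl; auto|]. intros x g Hx.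
  apply (gen_min G (fun z => exists a g, lcs G m a /\ z = comm a g)
    (fun x => lcs G (S m) (g^-1 * (x * g)))); [| |exact Hx].
  - destruct (lcs_subgroup (S m)) as (H1 & H2 & H3). repeat split.
    + now replace (g^-1 * (1 * g)) with (1:G) by word.
    + intros y z Hy Hz. replace (g^-1 * (y * z * g)) with ((g^-1 * (y * g)) * (g^-1 * (z * g))) by word.
      auto.
    + intros y Hy. replace (g^-1 * (y^-1 * g)) with ((g^-1 * (y * g))^-1) by word. auto.
  - intros z (a & h & Ha & ->).
    replace (g^-1 * (comm a h * g)) with (comm (g^-1 * (a * g)) (g^-1 * (h * g))) by word.
    apply lcs_comm. auto.
Qed.

Lemma lcs_anti m x : lcs G (S m) x -> lcs G m x.
Proof.
  apply gen_min; [apply lcs_subgroup|]. intros z (a & g & Ha & ->).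
  replace (comm a g) with (a^-1 * (g^-1 * (a * g))) by word.
  apply lcs_subgroup; [apply lcs_subgroup; auto | now apply lcs_normal].
Qed.

(** Modulo the next term the commutator is bilinear, so the commutators of generators of one layer
    with generators of G generate the following layer. *)
Lemma lcs_fg m : fin_gen G ->
  exists E, (forall x, In x E -> lcs G m x) /\
    forall x, lcs G m x -> gen (fun y => In y E \/ lcs G (S m) y) x.
Proof.
  intros [X HX]. induction m as [|m (E & HE & IH)].
  - exists X. split; [simpl; auto|]. intros x _. generalize (HX x). apply gen_mono. auto.
  - exists (flat_map (fun a => map (comm a) X) E).
    set (E' := flat_map (fun a => map (comm a) X) E). split.
    { intros x Hx. apply in_flat_map in Hx. destruct Hx as (a & Ha & Hx).
      apply in_map_iff in Hx. destruct Hx as (g & <- & _). now apply lcs_comm, HE. }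
    set (T := gen (fun y => In y E' \/ lcs G (S (S m)) y)).
    assert (TM : forall x y, T x -> T y -> T (x * y)) by apply gen_mul.
    assert (TI : forall x, T x -> T (x^-1)) by apply gen_inv.
    assert (T1 : T 1) by apply gen_one.
    assert (TL : forall x, lcs G (S (S m)) x -> T x) by (intros; apply gen_in; auto).
    assert (TJ : forall x g, lcs G (S m) x -> T x -> T (g^-1 * (x * g))).
    { intros x g Hx Tx. replace (g^-1 * (x * g)) with (x * comm x g) by word.
      apply TM; auto. now apply TL, lcs_comm. }
    assert (He : forall a, In a E -> forall g, T (comm a g)).
    { intros a Ha g. pose proof (HX g) as Hg.
      induction Hg as [x Hx| |x y _ IHx _ IHy|x _ IHx].
      - apply gen_in. left. apply in_flat_map. exists a. split; auto. now apply in_map.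
      - replace (comm a 1) with (1:G) by word. auto.
      - replace (comm a (x * y)) with (comm a y * (y^-1 * (comm a x * y))) by word.
        apply TM; auto. apply TJ; auto. now apply lcs_comm, HE.
      - replace (comm a (x^-1)) with (((x^-1)^-1 * (comm a x * x^-1))^-1) by word.
        apply TI, TJ; auto. now apply lcs_comm, HE. }
    intros x Hx. revert x Hx. apply gen_min; [apply gen_subgroup|].
    intros z (a & g & Ha & ->). revert g. fold T.
    specialize (IH a Ha).
    assert (Hall : forall a, gen (fun y => In y E \/ lcs G (S m) y) a ->
      lcs G m a /\ forall g, T (comm a g)).
    { apply gen_min.
      - destruct (lcs_subgroup m) as (L1 & L2 & L3). repeat split; auto.
        + intros g. replace (comm 1 g) with (1:G) by word. auto.
        + destruct H, H0. auto.
        + destruct H as [Hx Tx], H0 as [Hy Ty]. intros g.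
          replace (comm (x * y) g) with ((y^-1 * (comm x g * y)) * comm y g) by word.
          apply TM; auto. apply TJ; auto. now apply lcs_comm.
        + destruct H. auto.
        + destruct H as [Hx Tx]. intros g.
          replace (comm (x^-1) g) with (((x^-1)^-1 * (comm x g * x^-1))^-1) by word.
          apply TI, TJ; auto. now apply lcs_comm.
      - intros y [Hy|Hy]; split; auto.
        + now apply lcs_anti.
        + intros g. apply TL. now apply lcs_comm. }
    apply Hall, IH.
Qed.

Lemma lcs_polycyclic n : fin_gen G -> (forall x, lcs G n x -> x = 1) ->
  forall k m, m + k = n -> exists l, polycyclic l /\ forall x, genl l x <-> lcs G m x.
Proof.
  intros Hfg Hn. induction k as [|k IH]; intros m Hm.
  - exists []. split; [exact I|]. intros x. split; intros Hx.
    + apply genl_nil in Hx. subst x. apply lcs_subgroup.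
    + replace m with n in Hx by lia. apply Hn in Hx. subst x. apply gen_one.
  - destruct (IH (S m)) as (l & Hl & El); [lia|].
    destruct (lcs_fg m Hfg) as (E & HE & HEg).
    (* Elements of a layer may be prepended in any order: conjugating by them changes an element of
       the layer only by the next term, which [l] already generates. *)
    assert (Hext : forall E', (forall x, In x E' -> lcs G m x) ->
      polycyclic (E' ++ l) /\ forall x, genl (E' ++ l) x -> lcs G m x).
    { induction E' as [|c E' IHE]; simpl; intros HE'.
      - split; auto. intros x Hx. apply El in Hx. now apply lcs_anti.
      - destruct IHE as [IH1 IH2]; auto.
        assert (Hc : lcs G m c) by auto.
        assert (Hin : forall z, lcs G (S m) z -> genl (E' ++ l) z).
        { intros z Hz. apply El in Hz. revert Hz. apply genl_incl. intros. apply in_or_app; auto. }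
        repeat split; auto.
        + replace (c * (h * c^-1)) with (h * comm h (c^-1)) by word.
          apply gen_mul; [now apply gen_in|]. apply Hin, lcs_comm, IH2. now apply gen_in.
        + replace (c^-1 * (h * c)) with (h * comm h c) by word.
          apply gen_mul; [now apply gen_in|]. apply Hin, lcs_comm, IH2. now apply gen_in.
        + apply genl_sub; [apply lcs_subgroup|]. intros y [<-|Hy]; auto.
          apply IH2. now apply gen_in. }
    destruct (Hext E HE) as [H1 H2]. exists (E ++ l). split; auto.
    intros x. split; auto. intros Hx. apply HEg in Hx. revert Hx.
    apply gen_min; [apply gen_subgroup|]. intros y [Hy|Hy].
    + apply gen_in, in_or_app. auto.
    + apply El in Hy. revert Hy. apply genl_incl. intros. apply in_or_app; auto.
Qed.

Lemma fg_nilpotent_polycyclic : fin_gen G -> nilpotent G ->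
  exists l : list G, polycyclic l /\ forall x, genl l x.
Proof.
  intros Hfg [n Hn]. destruct (lcs_polycyclic n Hfg Hn n 0 eq_refl) as (l & Hl & E).
  exists l. split; auto. intros x. apply E. exact I.
Qed.

Lemma fg_nilpotent_noeth : fin_gen G -> nilpotent G -> noeth G.
Proof.
  intros H1 H2. destruct (fg_nilpotent_polycyclic H1 H2) as (l & Hl & E).
  intros P HP _. apply (polycyclic_noeth _ l Hl); auto.
Qed.
End LowerCentral.

(** * Noetherian groups and the upper central series *)

Lemma noeth_chain {G : Group} {S : G -> Prop} (P : nat -> G -> Prop) :
  noeth_on S -> (forall k, subgroup (P k)) -> (forall k x, P k x -> S x) ->
  (forall k x, P k x -> P (Datatypes.S k) x) ->
  exists k, forall m x, P m x -> P k x.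
Proof.
  intros HS HP HPS Hmon.
  assert (Hle : forall k m x, k <= m -> P k x -> P m x).
  { intros k m x Hkm. induction Hkm; auto. }
  destruct (HS (fun x => exists k, P k x)) as [l Hl].
  - repeat split.
    + exists 0. apply HP.
    + intros x y [k Hk] [m Hm]. exists (Nat.max k m).
      apply HP; [apply (Hle k) | apply (Hle m)]; auto; lia.
    + intros x [k Hk]. exists k. now apply HP.
  - intros x [k Hk]. eauto.
  - assert (Hk : exists k, forall x, In x l -> P k x).
    { assert (Hl' : forall x, In x l -> exists k, P k x).
      { intros x Hx. apply Hl. now apply gen_in. }
      clear Hl. induction l as [|x l IH].
      - exists 0. intros x [].
      - destruct IH as [k Hk]; [intros; apply Hl'; now right|].
        destruct (Hl' x) as [m Hm]; [now left|]. exists (Nat.max k m).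
        intros y [<-|Hy]; [apply (Hle m) | apply (Hle k)]; auto; lia. }
    destruct Hk as [k Hk]. exists k. intros m x Hx.
    apply (genl_sub _ l); auto. apply Hl. eauto.
Qed.

(** Well-founded induction along reverse inclusion: from a counterexample, repeated choice would
    build a strictly increasing chain. *)
Lemma noeth_ind {G : Group} {S : G -> Prop} (Q : (G -> Prop) -> Prop) : noeth_on S ->
  (forall P, subgroup P -> (forall x, P x -> S x) ->
    (forall P', subgroup P' -> (forall x, P' x -> S x) -> (forall x, P x -> P' x) ->
       (exists x, P' x /\ ~ P x) -> Q P') -> Q P) ->
  forall P, subgroup P -> (forall x, P x -> S x) -> Q P.
Proof.
  intros HS Hstep P0 HP0 HP0S. apply NNPP. intros HQ.
  set (bad := fun P : G -> Prop => subgroup P /\ (forall x, P x -> S x) /\ ~ Q P).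
  assert (Hnext : forall b : {P | bad P}, exists b' : {P | bad P},
    (forall x, proj1_sig b x -> proj1_sig b' x) /\ exists x, proj1_sig b' x /\ ~ proj1_sig b x).
  { intros (P & HP & HPS & HPQ). apply NNPP. intros Hno. apply HPQ, Hstep; auto.
    intros P' H1 H2 H3 H4. apply NNPP. intros H5. apply Hno.
    exists (exist _ P' (conj H1 (conj H2 H5))). auto. }
  set (next := fun b => proj1_sig (constructive_indefinite_description _ (Hnext b))).
  assert (Hn : forall b, (forall x, proj1_sig b x -> proj1_sig (next b) x) /\
    exists x, proj1_sig (next b) x /\ ~ proj1_sig b x).
  { intros b. unfold next. now destruct constructive_indefinite_description. }
  set (b0 := exist bad P0 (conj HP0 (conj HP0S HQ))).
  set (c := fix c k := match k with 0 => b0 | Datatypes.S k => next (c k) end).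
  destruct (noeth_chain (fun k => proj1_sig (c k)) HS) as [k Hk].
  - intros k. now destruct (c k) as (? & ? & ?).
  - intros k. now destruct (c k) as (? & ? & ? & ?).
  - intros k. apply (Hn (c k)).
  - destruct (Hn (c k)) as [_ (x & Hx & Hx')]. apply Hx'. now apply (Hk (Datatypes.S k)).
Qed.

Definition hom {G H : Group} (f : G -> H) : Prop := forall x y, f (x * y) = f x * f y.

Section Hom.
Variables (G H : Group) (f : G -> H).
Hypothesis Hf : hom f.
Lemma hom1 : f 1 = 1.
Proof. apply (mul_cancel_l _ (f 1)). rewrite <- Hf. word. Qed.
Lemma homV x : f (x^-1) = (f x)^-1.
Proof. apply inv_uniq. rewrite <- Hf, mulgV. apply hom1. Qed.
Lemma hom_zpow x k : f (zpow x k) = zpow (f x) k.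
Proof.
  induction k using Z.peano_ind; [apply hom1 | |].
  - now rewrite !zpow_succ, Hf, IHk.
  - now rewrite !zpow_pred, Hf, homV, IHk.
Qed.
Lemma hom_preimage (S : H -> Prop) : subgroup S -> subgroup (fun x => S (f x)).
Proof.
  intros (H1 & H2 & H3). repeat split.
  - now rewrite hom1.
  - intros. rewrite Hf. auto.
  - intros. rewrite homV. auto.
Qed.
End Hom.

Lemma hom_eq_gen {G H : Group} (f g : G -> H) (S : G -> Prop) : hom f -> hom g ->
  (forall x, S x -> f x = g x) -> forall x, gen S x -> f x = g x.
Proof.
  intros Hf Hg HS x Hx. induction Hx.
  - auto.
  - now rewrite !hom1.
  - rewrite Hf, Hg. congruence.
  - rewrite !homV; auto. congruence.
Qed.

(** The kernels of the iterates of f become stationary at some k. An element x of the kernel of f is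
    f^k(y), so y lies in the kernel of f^(k+1), hence in that of f^k, and x = 1. *)
Lemma hopfian {G : Group} (f : G -> G) : noeth G -> hom f -> (forall y, exists x, f x = y) ->
  forall x, f x = 1 -> x = 1.
Proof.
  intros HG Hf Hs.
  assert (Hi : forall k, hom (Nat.iter k f)).
  { induction k; intros x y; simpl; auto. now rewrite IHk, Hf. }
  assert (His : forall k y, exists x, Nat.iter k f x = y).
  { induction k; intros y; simpl; eauto. destruct (Hs y) as [z <-].
    destruct (IHk z) as [x <-]. eauto. }
  destruct (noeth_chain (fun k x => Nat.iter k f x = 1) HG) as [k Hk]; auto.
  - intros k. apply (hom_preimage _ _ _ (Hi k) (fun y => y = 1)).
    repeat split; intros; subst; word.
  - intros k x Hx. simpl. rewrite Hx. now apply hom1.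
  - intros x Hx. destruct (His k x) as [y <-]. apply (Hk (S k)). exact Hx.
Qed.

(** Multiplicativity is asked on S alone because the quotient maps used later are uncontrolled
    outside the subgroup they present. *)
Lemma noeth_image {G H : Group} (f : G -> H) (S : G -> Prop) : subgroup S -> noeth_on S ->
  (forall x y, S x -> S y -> f (x * y) = f x * f y) -> (forall y, exists x, S x /\ f x = y) ->
  noeth H.
Proof.
  intros HS HN Hf Hs P HP _. destruct HS as (S1 & SM & SI).
  assert (f1 : f 1 = 1).
  { apply (mul_cancel_l _ (f 1)). rewrite <- Hf, !mulg1; auto. }
  assert (fV : forall x, S x -> f (x^-1) = (f x)^-1).
  { intros x Hx. apply inv_uniq. rewrite <- Hf, mulgV; auto. }
  destruct HP as (P1 & PM & PI).
  destruct (HN (fun x => S x /\ P (f x))) as [l Hl].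
  { split; [now rewrite f1 | split].
    - intros x y [] []. rewrite Hf; auto.
    - intros x []. rewrite fV; auto. }
  { tauto. }
  exists (map f l). intros y. split.
  - intros Hy. destruct (Hs y) as (x & Hx & <-).
    assert (Hx' : genl l x) by (apply Hl; auto).
    assert (Hgen : forall x, genl l x -> S x /\ genl (map f l) (f x)).
    { apply gen_min.
      - split; [rewrite f1; split; auto; apply gen_one | split].
        + intros u v [] []. rewrite Hf; auto. split; auto. now apply gen_mul.
        + intros u []. rewrite fV; auto. split; auto. now apply gen_inv.
      - intros z Hz. split; [apply Hl; now apply gen_in|]. apply gen_in. now apply in_map. }
    now apply Hgen.
  - apply genl_sub; [repeat split; auto|]. intros z Hz. apply in_map_iff in Hz.
    destruct Hz as (x & <- & Hx). apply Hl. now apply gen_in.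
Qed.

Definition fung (T : Type) (G : Group) : Group.
Proof.
  refine {| carrier := T -> G;
            gmul := fun x y t => x t * y t;
            ginv := fun x t => (x t)^-1;
            gone := fun _ => 1 |}; intros; extensionality t.
  - apply gmul_assoc.
  - apply mul1g.
  - apply mulg1.
  - apply mulVg.
  - apply mulgV.
Defined.

(** This is the Noetherian property of G^n. The induction splits off the last coordinate: tuples of
    P trivial before it have their last coordinates in a subgroup of G. *)
Lemma noeth_tuple {G : Group} n (P : fung nat G -> Prop) : noeth G -> subgroup P ->
  exists l, (forall v, In v l -> P v) /\
    forall v, P v -> exists w, genl l w /\ forall j, j < n -> w j = v j.
Proof.
  intros HG HP. assert (HP' := HP). destruct HP' as (P1 & PM & PI). induction n as [|n (l1 & Hl1 & IH)].
  - exists []. split; [intros v []|]. intros v _. exists 1. split; [apply gen_one | lia].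
  - set (Q := fun v : fung nat G => P v /\ forall j, j < n -> v j = 1).
    assert (HQ : subgroup Q).
    { unfold Q. split; [auto | split].
      - intros x y [Hx Ex] [Hy Ey]. split; auto. intros j Hj. simpl.
        rewrite Ex, Ey by auto. word.
      - intros x [Hx Ex]. split; auto. intros j Hj. simpl. rewrite Ex by auto. word. }
    destruct (HG (fun x => exists v, Q v /\ v n = x)) as [lx Hlx].
    { destruct HQ as (Q1 & QM & QI). repeat split.
      - exists 1. auto.
      - intros x y (v & Hv & <-) (w & Hw & <-). exists (v * w). auto.
      - intros x (v & Hv & <-). exists (v^-1). auto. }
    { auto. }
    assert (Hl2 : exists l2, (forall v, In v l2 -> Q v) /\
      forall x, In x lx -> exists v, In v l2 /\ v n = x).
    { assert (Hlx' : forall x, In x lx -> exists v, Q v /\ v n = x).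
      { intros x Hx. apply Hlx. now apply gen_in. }
      clear Hlx. induction lx as [|x lx IHx].
      - exists []. split; [intros v [] | intros x []].
      - destruct IHx as (l2 & H1 & H2); [intros; apply Hlx'; now right|].
        destruct (Hlx' x) as (v & Hv & Ev); [now left|]. exists (v :: l2). split.
        + intros w [<-|Hw]; auto.
        + intros y [<-|Hy]; [exists v; simpl; auto|].
          destruct (H2 y Hy) as (w & Hw & Ew). exists w. simpl. auto. }
    destruct Hl2 as (l2 & H1 & H2). exists (l1 ++ l2). split.
    { intros v Hv. apply in_app_or in Hv. destruct Hv as [Hv|Hv]; auto. now apply H1. }
    assert (H3 : forall x, genl lx x -> exists v, genl l2 v /\ v n = x).
    { apply gen_min.
      - repeat split.
        + exists 1. split; [apply gen_one | reflexivity].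
        + intros x y (v & Hv & <-) (w & Hw & <-). exists (v * w). split; [now apply gen_mul | reflexivity].
        + intros x (v & Hv & <-). exists (v^-1). split; [now apply gen_inv | reflexivity].
      - intros x Hx. destruct (H2 x Hx) as (v & Hv & Ev). exists v. split; auto. now apply gen_in. }
    intros v Hv. destruct (IH v Hv) as (w & Hw & Ew).
    assert (HwP : P w) by (apply (genl_sub _ l1); auto).
    assert (Hu : Q (w^-1 * v)).
    { split; auto. intros j Hj. simpl. rewrite Ew by auto. word. }
    destruct (H3 ((w^-1 * v) n)) as (u & Hu1 & Hu2).
    { apply Hlx. eauto. }
    assert (HuQ : Q u) by (apply (genl_sub _ l2); auto).
    exists (w * u). split.
    { apply gen_mul; [revert Hw | revert Hu1]; apply genl_incl; intros; apply in_or_app; auto. }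
    intros j Hj. simpl. destruct (Nat.eq_dec j n) as [->|Hjn].
    + rewrite Hu2. simpl. word.
    + destruct HuQ as [_ HuQ]. rewrite HuQ, Ew by lia. word.
Qed.

(** The upper series is used for H because each of its terms is visibly first-order, whereas
    membership in [lcs] involves products of unbounded length. *)
Fixpoint ucs (G : Group) (i : nat) : G -> Prop :=
  match i with
  | 0 => fun x => x = 1
  | S i => fun x => forall g, ucs G i (comm x g)
  end.
Arguments ucs {G} i x.

Definition normal {G : Group} (N : G -> Prop) : Prop :=
  subgroup N /\ forall g x, N x -> N (g^-1 * (x * g)).

Section UpperCentral.
Variable G : Group.
Implicit Types x y g : G.

Lemma ucs_normal i : normal (ucs (G := G) i).
Proof.
  induction i as [|i [(H1 & HM & HI) HN]]; simpl.
  - repeat split; intros; subst; word.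
  - repeat split.
    + intros g. now replace (comm 1 g) with (1:G) by word.
    + intros x y Hx Hy g.
      replace (comm (x * y) g) with (y^-1 * (comm x g * y) * comm y g) by word. auto.
    + intros x Hx g.
      replace (comm (x^-1) g) with (((x^-1)^-1 * (comm x g * x^-1))^-1) by word. auto.
    + intros g x Hx h.
      replace (comm (g^-1 * (x * g)) h) with (g^-1 * (comm x (g * (h * g^-1)) * g)) by word.
      auto.
Qed.

Lemma ucs_subgroup i : subgroup (ucs (G := G) i).
Proof. apply ucs_normal. Qed.

Lemma ucs_S i x : ucs i x -> ucs (S i) x.
Proof.
  intros Hx g. replace (comm x g) with (x^-1 * (g^-1 * (x * g))) by word.
  destruct (ucs_normal i) as [(H1 & HM & HI) HN]. auto.
Qed.

Lemma lcs_ucs n : (forall x, lcs G n x -> x = 1) -> forall k m, m + k = n -> forall x, lcs G m x -> ucs k x.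
Proof.
  intros Hn. induction k; intros m Hm x Hx.
  - apply Hn. now replace n with m by lia.
  - intros g. apply (IHk (S m)); [lia|]. now apply lcs_comm.
Qed.

Lemma nilpotent_ucs : nilpotent G -> exists c, forall x, ucs c x.
Proof.
  intros [n Hn]. exists n. intros x. apply (lcs_ucs n Hn n 0); simpl; auto.
Qed.

Lemma ucs_nilpotent c : (forall x, ucs c x) -> nilpotent G.
Proof.
  intros Hc. exists c.
  assert (H : forall m k, m + k = c -> forall x, lcs G m x -> ucs k x).
  { induction m; intros k Hk x Hx.
    - simpl in Hk. subst. apply Hc.
    - revert x Hx. apply gen_min; [apply ucs_subgroup|]. intros z (a & g & Ha & ->).
      apply (IHm (S k)); [lia | auto]. }
  intros x Hx. apply (H c 0); auto.
Qed.

Lemma center_ucs x : center G x <-> ucs 1 x.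
Proof.
  simpl. split; intros H g.
  - unfold comm. rewrite (H g). word.
  - pose proof (H g) as E. apply inv_uniq in E. revert E. rewrite invM, !invK.
    intros ->. reflexivity.
Qed.
End UpperCentral.

Lemma definable_ucs i : forall X, is_term X -> definable (fun G e => ucs i (X G e)).
Proof.
  induction i; intros X HX; simpl.
  - apply definable_eq; tm.
  - apply definable_all, IHi; tm.
Qed.

(** * The ring of scalars of a bilinear map *)

Section Scalars.
Variables (G L M : Group) (f : L -> G -> M).
Hypothesis fL : forall a b g, f (a * b) g = f a g * f b g.
Hypothesis fG : forall a g h, f a (g * h) = f a g * f a h.
Hypothesis nd : forall a, (forall g, f a g = 1) -> a = 1.
Hypothesis Lc : forall a b : L, a * b = b * a.
Hypothesis HL : noeth L.

(** Additivity of m is not part of the definition: it follows from bilinearity and non-degeneracy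
    ([adjointable_hom]). *)
Definition adjointable (m : L -> L) : Prop := forall g, exists u, forall a, f (m a) g = f a u.
(** The center of the ring of adjointable maps. The group law of [fung L L] is the addition of this
    ring and composition is its multiplication. *)
Definition scalar (m : fung L L) : Prop :=
  adjointable m /\ forall m', adjointable m' -> forall a, m (m' a) = m' (m a).

Let fL1 g : f 1 g = 1.
Proof. apply (hom1 L M (fun a => f a g)). intros a b. apply fL. Qed.
Let fLV a g : f (a^-1) g = (f a g)^-1.
Proof. apply (homV L M (fun a => f a g)). intros x y. apply fL. Qed.
Let fG1 a : f a 1 = 1.
Proof. apply (hom1 G M (f a)). intros x y. apply fG. Qed.
Let fGV a g : f a (g^-1) = (f a g)^-1.
Proof. apply (homV G M (f a)). intros x y. apply fG. Qed.

Lemma nondeg_inj a b : (forall g, f a g = f b g) -> a = b.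
Proof.
  intros H. assert (E : a * b^-1 = 1).
  { apply nd. intros g. rewrite fL, fLV, H. word. }
  apply inv_uniq in E. rewrite <- (invK _ b), E. word.
Qed.

Lemma adjointable_hom m : adjointable m -> hom (G := L) (H := L) m.
Proof.
  intros Hm a b. apply nondeg_inj. intros g. destruct (Hm g) as [u Hu].
  now rewrite fL, !Hu, fL.
Qed.

Lemma scalar_hom m : scalar m -> hom (G := L) (H := L) m.
Proof. intros []. now apply adjointable_hom. Qed.

Lemma scalar_subgroup : subgroup scalar.
Proof.
  repeat split.
  - intros g. exists 1. intros a. simpl. now rewrite fG1, fL1.
  - intros m Hm a. simpl. symmetry. now apply hom1, adjointable_hom.
  - destruct H as [Hx _], H0 as [Hy _]. intros g.
    destruct (Hx g) as [u Hu], (Hy g) as [v Hv]. exists (u * v). intros a. simpl.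
    now rewrite fL, fG, Hu, Hv.
  - destruct H as [_ Hx], H0 as [_ Hy]. intros m Hm a. simpl.
    rewrite Hx, Hy by auto. symmetry. now apply adjointable_hom.
  - destruct H as [Hx _]. intros g. destruct (Hx g) as [u Hu]. exists (u^-1). intros a. simpl.
    now rewrite fLV, fGV, Hu.
  - destruct H as [_ Hx]. intros m Hm a. simpl. rewrite Hx by auto.
    symmetry. now apply homV, adjointable_hom.
Qed.

Lemma scalar_comp m m' : scalar m -> scalar m' -> scalar (fun a => m (m' a)).
Proof.
  intros [H1 H2] [H1' H2']. split.
  - intros g. destruct (H1 g) as [u Hu]. destruct (H1' u) as [v Hv]. exists v. intros a.
    now rewrite Hu, Hv.
  - intros n Hn a. now rewrite H2', H2.
Qed.

Lemma scalar_id : scalar (fun a => a).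
Proof. split; [intros g; now exists g | auto]. Qed.

Lemma scalar_commute m m' a : scalar m -> scalar m' -> m (m' a) = m' (m a).
Proof. intros [_ H] [H' _]. now apply H. Qed.

(** A scalar is additive, hence determined by its values on finitely many generators of L; this
    embeds the scalars into a finite power of L. *)
Lemma scalar_noeth : noeth_on scalar.
Proof.
  intros P HP HPS.
  destruct (HL (fun _ => True)) as [z Hz]; [repeat split | auto |].
  set (ev := fun m : fung L L => (fun k => m (nth_env z k)) : fung nat L).
  assert (Hev : hom ev) by (intros x y; reflexivity).
  destruct (noeth_tuple (length z) (fun t => exists m, P m /\ ev m = t) HL) as (l & Hl & Hgen).
  { destruct HP as (P1 & PM & PI). repeat split.
    - exists 1. auto.
    - intros x y (m & Hm & <-) (n & Hn & <-). exists (m * n). auto.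
    - intros x (m & Hm & <-). exists (m^-1). auto. }
  assert (Hls : exists ls, (forall m, In m ls -> P m) /\
     forall t, In t l -> exists m, In m ls /\ ev m = t).
  { clear Hgen. induction l as [|t l IH].
    - exists []. split; [intros ? [] | intros ? []].
    - destruct IH as (ls & H1 & H2); [intros; apply Hl; now right|].
      destruct (Hl t) as (m & Hm & Em); [now left|]. exists (m :: ls). split.
      + intros n [<-|Hn]; auto.
      + intros s [<-|Hs]; [exists m; simpl; auto|].
        destruct (H2 s Hs) as (n & Hn & En). exists n. simpl. auto. }
  destruct Hls as (ls & H1 & H2). exists ls. intros m. split.
  - intros Hm. destruct (Hgen (ev m)) as (t & Ht & Et); [eauto|].
    assert (Hex : forall t, genl l t -> exists n, genl ls n /\ ev n = t).
    { apply gen_min.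
      - repeat split.
        + exists 1. split; [apply gen_one | reflexivity].
        + intros x y (n & Hn & <-) (n' & Hn' & <-). exists (n * n').
          split; [now apply gen_mul | reflexivity].
        + intros x (n & Hn & <-). exists (n^-1). split; [now apply gen_inv | reflexivity].
      - intros s Hs. destruct (H2 s Hs) as (n & Hn & En). exists n. split; auto.
        now apply gen_in. }
    destruct (Hex t Ht) as (n & Hn & En).
    assert (HnP : P n) by (apply (genl_sub _ ls); auto).
    replace m with n; auto. extensionality a.
    assert (Ha : genl z a) by (apply Hz; exact I). apply genl_rng in Ha.
    apply (hom_eq_gen n m (range (nth_env z) (length z))); auto using scalar_hom.
    intros x (j & Hj & ->). subst t. exact (Et j Hj).
  - apply genl_sub; auto.
Qed.

(* The R-submodule of L generated by [l], where R is the ring of scalars. *)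
Fixpoint span (l : list L) (a : L) : Prop :=
  match l with
  | [] => a = 1
  | a1 :: l => exists m : fung L L, scalar m /\ span l ((m a1)^-1 * a)
  end.

Lemma span_subgroup l : subgroup (span l).
Proof.
  destruct scalar_subgroup as (S1 & SM & SI).
  induction l as [|c l (I1 & IM & II)]; simpl.
  - repeat split; intros; subst; word.
  - repeat split.
    + exists (1 : fung L L). split; auto.
    + intros x y (m & Hm & Hx) (n & Hn & Hy). exists ((m : fung L L) * n). split; auto. simpl.
      replace ((m c * n c)^-1 * (x * y)) with (((m c)^-1 * x) * ((n c)^-1 * y)); auto.
      rewrite invM, !mulA, (Lc ((n c)^-1) ((m c)^-1 * (x * y))), !mulA.
      do 2 f_equal. apply Lc.
    + intros x (m & Hm & Hx). exists ((m : fung L L)^-1). split; auto. simpl.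
      replace (((m c)^-1)^-1 * x^-1) with (((m c)^-1 * x)^-1); auto. word. apply Lc.
Qed.

Lemma span_scal l m a : scalar m -> span l a -> span l (m a).
Proof.
  intros Hm. revert a. induction l as [|c l IH]; simpl; intros a.
  - intros ->. now apply hom1, scalar_hom.
  - intros (n & Hn & Ha). exists (fun x => m (n x)). split; [now apply scalar_comp|].
    apply IH in Ha. rewrite (scalar_hom m Hm), (homV _ _ m) in Ha; auto using scalar_hom.
Qed.

Lemma span_cons l c a : span l a -> span (c :: l) a.
Proof.
  exists (1 : fung L L). split; [apply scalar_subgroup|]. simpl.
  now replace (1^-1 * a) with a by word.
Qed.

Lemma span_head l c : span (c :: l) c.
Proof.
  exists (fun a => a). split; [apply scalar_id|]. rewrite mulVg. apply span_subgroup.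
Qed.

(** The annihilator of the class of a in L modulo [span l] is a prime ideal. *)
Definition prime_at (l : list L) (a : L) : Prop := ~ span l a /\
  forall m n : fung L L, scalar m -> scalar n -> span l (m (n a)) -> span l (m a) \/ span l (n a).

(* A maximal annihilator is prime. *)
Lemma exists_prime l a : ~ span l a -> exists b, prime_at l b.
Proof.
  set (Q := fun P : fung L L -> Prop => forall a, ~ span l a ->
    (forall m, P m <-> scalar m /\ span l (m a)) -> exists b, prime_at l b).
  assert (HA : forall a, subgroup (fun m => scalar m /\ span l (m a))).
  { intros c. destruct scalar_subgroup as (S1 & SM & SI), (span_subgroup l) as (I1 & IM & II).
    split; [auto | split].
    - intros x y [] []. split; [now apply SM | now apply IM].
    - intros x []. split; [now apply SI | now apply II]. }
  assert (H : forall P, subgroup P -> (forall x, P x -> scalar x) -> Q P).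
  { apply (noeth_ind Q scalar_noeth). intros P HP HPS IH c Hc Ec.
    destruct (classic (prime_at l c)) as [Hp|Hp]; [eauto|].
    assert (Hex : exists m n : fung L L, scalar m /\ scalar n /\ span l (m (n c)) /\ ~ span l (m c) /\ ~ span l (n c)).
    { apply NNPP. intros Hno. apply Hp. split; auto. intros m n Hm Hn Hmn.
      apply NNPP. intros Hor. apply Hno. exists m, n. tauto. }
    destruct Hex as (m & n & Hm & Hn & Hmn & H1 & H2).
    (* Passing from c to n c enlarges the annihilator: nothing is lost, since scalars commute, and m
       is gained. *)
    apply (IH (fun m' => scalar m' /\ span l (m' (n c))) (HA (n c))) with (a := n c); auto.
    - tauto.
    - intros x Hx. apply Ec in Hx. destruct Hx as [Hx Hxc]. split; auto.
      rewrite scalar_commute by auto. now apply span_scal.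
    - exists m. split; auto. intros Hm'. apply Ec in Hm'. tauto.
    - tauto. }
  intros Ha. apply (H _ (HA a)) with (a := a); tauto.
Qed.

Fixpoint good (l : list L) : Prop :=
  match l with [] => True | a :: l => prime_at l a /\ good l end.

(** The usual filtration of a Noetherian module with factors R/p. The list grows at its head, so
    each member is prime over the span of the members after it. *)
Lemma prime_filtration : exists l, good l /\ forall a, span l a.
Proof.
  set (Q := fun P : L -> Prop => forall l, good l -> (forall a, P a <-> span l a) ->
    exists l', good l' /\ forall a, span l' a).
  assert (H : forall P, subgroup P -> (forall x, P x -> True) -> Q P).
  { apply (noeth_ind Q HL). intros P HP _ IH l Hl E.
    destruct (classic (forall a, span l a)) as [Hall|Hnall]; [eauto|].
    apply not_all_ex_not in Hnall. destruct Hnall as [a Ha].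
    destruct (exists_prime l a Ha) as [b Hb].
    apply (IH (span (b :: l))) with (l := b :: l); auto.
    - apply span_subgroup.
    - intros x Hx. apply span_cons. now apply E.
    - exists b. split; [apply span_head|]. rewrite E. apply Hb.
    - now split.
    - reflexivity. }
  apply (H _ (span_subgroup [])) with (l := []); simpl; tauto.
Qed.

(* Horner evaluation of the monic polynomial X^n + c_{n-1} X^{n-1} + ... + c_0 at [m]. *)
Fixpoint heval (cs : list (fung L L)) (m : L -> L) (a : L) : L :=
  match cs with
  | [] => a
  | c :: cs => c a * m (heval cs m a)
  end.

Lemma scalar_pe cs m : (forall c, In c cs -> scalar c) -> scalar m -> scalar (heval cs m).
Proof.
  intros Hcs Hm. induction cs as [|c cs IH]; [apply scalar_id|].
  apply (proj1 (proj2 scalar_subgroup) c (fun a => m (heval cs m a))).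
  - apply Hcs. now left.
  - apply scalar_comp; auto. apply IH. intros; apply Hcs; now right.
Qed.

(** Synthetic division by X - r, giving P(m) = P(r) + (m - r) Q(m) with Q monic of degree one less;
    the coefficients of Q are the partial Horner values of P at r. *)
Lemma heval_divide cs : forall c r, (forall c', In c' (c :: cs) -> scalar c') -> scalar r ->
  exists cs', length cs' = length cs /\ (forall c', In c' cs' -> scalar c') /\
  forall m a, scalar m ->
    heval (c :: cs) m a = heval (c :: cs) r a * ((r (heval cs' m a))^-1 * m (heval cs' m a)).
Proof.
  induction cs as [|c1 cs IH]; intros c r Hcs Hr.
  - exists []. split; [auto | split; [intros ? []|]]. simpl. intros m a _. word.
  - destruct (IH c1 r) as (cs' & Hlen & Hcs' & E); auto.
    { intros; apply Hcs; now right. }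
    exists (heval (c1 :: cs) r :: cs'). split; [exact (f_equal S Hlen) | split].
    { intros c' [<-|Hc']; auto. apply scalar_pe; auto. intros; apply Hcs; now right. }
    intros m a Hm. specialize (E m a Hm).
    change (c a * m (heval (c1 :: cs) m a) = (c a * r (heval (c1 :: cs) r a)) *
      ((r (heval (c1 :: cs) r a * m (heval cs' m a)))^-1 * m (heval (c1 :: cs) r a * m (heval cs' m a)))).
    rewrite E. set (x := heval (c1 :: cs) r a). set (y := heval cs' m a).
    pose proof (scalar_hom m Hm) as Hmh. pose proof (scalar_hom r Hr) as Hrh.
    rewrite !Hmh, (homV _ _ m), Hrh by auto. rewrite (scalar_commute m r) by auto.
    clearbody x y. rewrite invM, !mulA. f_equal.
    rewrite (gmul_assoc _ ((r (m y))^-1) ((r x)^-1)), (Lc ((r (m y))^-1) ((r x)^-1)).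
    rewrite mulA, mulKVg, !gmul_assoc. f_equal. apply Lc.
Qed.

(** A monic polynomial over the domain R/ann(a) has at most as many roots as its degree. The empty
    list is the polynomial 1, which has no root because a is not in the span. *)
Lemma finite_roots l a : prime_at l a -> forall n cs, length cs = n ->
  (forall c, In c cs -> scalar c) ->
  exists rs, (forall r, In r rs -> scalar r) /\
    forall m : fung L L, scalar m -> span l (heval cs m a) -> exists r, In r rs /\ span l ((r a)^-1 * m a).
Proof.
  intros [Ha Hp]. induction n as [|n IH]; intros [|c cs] Hlen Hcs; try discriminate.
  - exists []. split; [intros ? []|]. simpl. tauto.
  - injection Hlen as Hlen.
    destruct (classic (exists r, scalar r /\ span l (heval (c :: cs) r a))) as [(r & Hr & Hra)|Hno].
    2:{ exists []. split; [intros ? []|]. intros m Hm Hma. exfalso. eauto. }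
    destruct (heval_divide cs c r Hcs Hr) as (cs' & Hlen' & Hcs' & E).
    destruct (IH cs') as (rs & Hrs & Hroot); [exact (eq_trans Hlen' Hlen) | auto |].
    exists (r :: rs). split; [intros ? [<-|]; auto|]. intros m Hm Hma.
    rewrite (E m a Hm) in Hma. apply subgroup_ldiv in Hma; [|apply span_subgroup | auto].
    (* P(m) a and P(r) a lie in the span, hence so does (m - r) Q(m) a. Primality leaves two cases:
       m agrees with r at a, or m is a root of Q there. *)
    destruct (Hp ((r : fung L L)^-1 * m) (heval cs' m)) as [H|H].
    + apply scalar_subgroup; auto. now apply scalar_subgroup.
    + now apply scalar_pe.
    + exact Hma.
    + exists r. simpl. auto.
    + destruct (Hroot m Hm H) as (r' & Hr' & Hr''). exists r'. simpl. auto.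
Qed.

(** * Integrality of scalars, and lists of root values *)

Definition zscalar (k : Z) : fung L L := fun a => zpow a k.

Lemma scalar_zc k : scalar (zscalar k).
Proof.
  replace (zscalar k) with (zpow (G := fung L L) (fun a => a) k).
  - apply subgroup_zpow; [apply scalar_subgroup | apply scalar_id].
  - extensionality a.
    exact (hom_zpow (fung L L) L (fun m => m a) (fun x y => eq_refl) (fun a => a) k).
Qed.

(** Unlike [heval], there is no leading term: these are all integer polynomials of degree below the
    length of the list, so they form a group. *)
Fixpoint zheval (ks : list Z) (m : L -> L) (a : L) : L :=
  match ks with
  | [] => 1
  | k :: ks => zpow a k * m (zheval ks m a)
  end.

(** The additive groups spanned by 1, m, ..., m^(d-1) increase with d and become stationary, so some
    m^d is an integer combination of lower powers. *)
Lemma scalar_integral m : scalar m -> exists ks, forall a, heval (map zscalar ks) m a = 1.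
Proof.
  intros Hm. pose proof (scalar_hom m Hm) as Hmh.
  assert (Hhv : forall ks, scalar (zheval ks m)).
  { destruct scalar_subgroup as (S1 & SM & SI). induction ks as [|k ks IH]; [exact S1|].
    apply (SM (zscalar k) (fun a => m (zheval ks m a))); [apply scalar_zc | now apply scalar_comp]. }
  destruct (noeth_chain (fun d (n : fung L L) => exists ks, length ks = d /\ n = zheval ks m) scalar_noeth)
    as [d Hd].
  - intros d. split; [|split].
    + exists (repeat 0%Z d). split; [apply repeat_length|]. extensionality a.
      induction d; simpl in *; auto. rewrite <- IHd, (hom1 L L m Hmh). word.
    + intros x y (ks & Hks & ->) (ks' & Hks' & ->). revert ks ks' Hks Hks'.
      induction d; intros [|k ks] [|k' ks'] Hks Hks'; try discriminate.
      * exists []. split; auto. extensionality a. simpl. word.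
      * injection Hks as Hks. injection Hks' as Hks'.
        destruct (IHd ks ks' Hks Hks') as (ks'' & Hks'' & E).
        exists ((k + k')%Z :: ks''). split; [simpl; congruence|]. extensionality a.
        apply (f_equal (fun g => g a)) in E. simpl in *. rewrite <- E, Hmh, zpow_add, !mulA.
        f_equal. rewrite !gmul_assoc. f_equal. apply Lc.
    + intros x (ks & Hks & ->). exists (map Z.opp ks). split; [now rewrite length_map|].
      extensionality a. clear Hks. induction ks as [|k ks IH]; simpl; [word|].
      rewrite <- IH. simpl. rewrite (homV L L m Hmh), zpow_opp, invM by auto. apply Lc.
  - intros d n (ks & _ & ->). apply Hhv.
  - intros d n (ks & Hks & ->). exists (ks ++ [0%Z]). split; [rewrite length_app; simpl; lia|].
    extensionality a. clear Hks. induction ks as [|k ks IH]; simpl; [|congruence].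
    rewrite (hom1 L L m Hmh). word.
  - assert (Hpow : forall d a, zheval (repeat 0%Z d ++ [1%Z]) m a = Nat.iter d m a).
    { intros d' a. induction d'; simpl.
      - rewrite (hom1 L L m Hmh), mulg1. apply (zpow_1 L).
      - rewrite IHd'. word. }
    destruct (Hd (S d) (zheval (repeat 0%Z d ++ [1%Z]) m)) as (ks & Hks & E).
    { eexists. split; [|reflexivity]. rewrite length_app, repeat_length. simpl. lia. }
    (* Moving the combination to the other side of m^d = [zheval ks m] negates its coefficients and
       makes the relation monic. *)
    exists (map Z.opp ks). intros a.
    assert (Hpe : heval (map zscalar (map Z.opp ks)) m a = Nat.iter (length ks) m a * (zheval ks m a)^-1).
    { clear -Hmh Lc. induction ks as [|k ks IH]; [simpl; word|].
      change (zpow a (- k) * m (heval (map zscalar (map Z.opp ks)) m a) =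
        m (Nat.iter (length ks) m a) * (zpow a k * m (zheval ks m a))^-1).
      rewrite IH, Hmh, (homV L L m Hmh), zpow_opp by auto.
      rewrite invM, Lc, !mulA. reflexivity. }
    rewrite Hpe, Hks, <- Hpow, E. word.
Qed.

(** A stage pairs a generator a with finitely many values: every scalar that satisfies a polynomial
    of [ps] at a takes one of them there, modulo the later stages. Nothing links [ps] to the group,
    so it can come from another group. *)
Fixpoint covers (ps : list (list Z)) (st : list (L * list L)) : Prop :=
  match st with
  | [] => True
  | (a, ws) :: st' =>
      (forall ks, In ks ps -> forall m : fung L L, scalar m ->
         span (map fst st') (heval (map zscalar ks) m a) ->
         exists w, In w ws /\ span (map fst st') (w^-1 * m a)) /\
      covers ps st'
  end.

Lemma exists_cover ps : exists st, covers ps st /\ forall a, span (map fst st) a.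
Proof.
  destruct prime_filtration as (l & Hl & Htot).
  assert (H : exists st, covers ps st /\ map fst st = l).
  { clear Htot. induction l as [|a l IH].
    - exists []. simpl. auto.
    - destruct Hl as [Hp Hl]. destruct (IH Hl) as (st & Hst & E).
      assert (Hws : exists ws, forall ks, In ks ps -> forall m, scalar m ->
         span l (heval (map zscalar ks) m a) -> exists w, In w ws /\ span l (w^-1 * m a)).
      { clear -Hp Lc fL fG fL1 fLV fG1 fGV nd HL. induction ps as [|ks ps [ws IH]].
        - exists []. intros ks [].
        - destruct (finite_roots l a Hp _ (map zscalar ks) eq_refl) as (rs & _ & Hrs).
          { intros c Hc. apply in_map_iff in Hc. destruct Hc as (k & <- & _). apply scalar_zc. }
          exists (map (fun r => r a) rs ++ ws). intros ks' [<-|Hks'] m Hm Hma.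
          + destruct (Hrs m Hm Hma) as (r & Hr & H). exists (r a). split; auto.
            apply in_or_app. left. apply (in_map (fun r : fung L L => r a)), Hr.
          + destruct (IH ks' Hks' m Hm Hma) as (w & Hw & H). exists w. split; auto.
            apply in_or_app. auto. }
      destruct Hws as [ws Hws]. exists ((a, ws) :: st). simpl. rewrite E. auto. }
  destruct H as (st & Hst & E). exists st. split; auto. now rewrite E.
Qed.

Definition annihilates (ps : list (list Z)) : Prop :=
  exists ms, (forall m, scalar m -> genl ms m) /\ (forall m, In m ms -> scalar m) /\
    forall m, In m ms -> exists ks, In ks ps /\ forall a, heval (map zscalar ks) m a = 1.

Lemma exists_annihilating : exists ps, annihilates ps.
Proof.
  destruct (scalar_noeth scalar scalar_subgroup) as [ms Hms]; auto.
  assert (Hms' : forall m, In m ms -> scalar m) by (intros; now apply Hms, gen_in).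
  assert (H : exists ps, forall m, In m ms -> exists ks, In ks ps /\ forall a, heval (map zscalar ks) m a = 1).
  { clear Hms. induction ms as [|m ms IH].
    - exists []. intros m [].
    - destruct IH as [ps Hps]; [intros; apply Hms'; now right|].
      destruct (scalar_integral m) as [ks Hks]; [apply Hms'; now left|].
      exists (ks :: ps). intros n [<-|Hn]; [exists ks; simpl; auto|].
      destruct (Hps n Hn) as (ks' & H1 & H2). exists ks'. simpl. auto. }
  destruct H as [ps Hps]. exists ps, ms. split; [intros m; apply Hms | auto].
Qed.

(** Additive generators of the ring of scalars are roots of [ps], so they send each stage generator
    to a listed value modulo the later stages. Hence a subgroup containing the listed values
    contains the whole module. *)
Lemma cover_generates ps st (X : L -> Prop) : annihilates ps -> covers ps st ->
  subgroup X -> (forall p w, In p st -> In w (snd p) -> X w) ->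
  forall a, span (map fst st) a -> X a.
Proof.
  intros (ms & Hgen & Hms & Hps) Hcov HX. induction st as [|[c ws] st IH]; simpl; intros HXw a.
  - intros ->. apply HX.
  - destruct Hcov as [Hc Hcov]. intros (m & Hm & Ha).
    assert (HI : forall b, span (map fst st) b -> X b).
    { apply IH; auto. intros p w Hp Hw. apply (HXw p); auto. }
    apply HI in Ha.
    assert (Hmc : X (m c)).
    (* The scalars m with m c in X form a subgroup, so additive generators are enough. *)
    { apply Hgen in Hm. clear Ha. revert m Hm.
      apply (gen_min (fung L L) _ (fun m => X (m c))).
      - destruct HX as (X1 & XM & XI). repeat split; simpl; auto.
      - intros n Hn. destruct (Hps n Hn) as (ks & Hks & E).
        destruct (Hc ks Hks n (Hms n Hn)) as (w & Hw & Hnw).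
        { rewrite E. apply span_subgroup. }
        apply HI in Hnw. replace (n c) with (w * (w^-1 * n c)) by word.
        apply HX; auto. apply (HXw (c, ws)); simpl; auto. }
    replace a with (m c * ((m c)^-1 * a)) by word. now apply HX.
Qed.
End Scalars.

(** * Encoding scalars by tuples of group elements *)

(* [p] presents the group Q as the quotient A/B; nothing is said about [p] outside A. *)
Definition subquo {G Q : Group} (A B : G -> Prop) (p : G -> Q) : Prop :=
  (forall a b, A a -> A b -> p (a * b) = p a * p b) /\
  (forall a b, A a -> A b -> (p a = p b <-> B (a^-1 * b))) /\
  (forall x, exists a, A a /\ p a = x).

(** The quotient is carried by chosen coset representatives. Two elements of one coset define the
    same predicate by extensionality, so [epsilon] picks the same representative for both. *)
Lemma exists_subquo (G : Group) (A B : G -> Prop) : subgroup A -> normal B ->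
  (forall x, B x -> A x) -> exists (Q : Group) (p : G -> Q), subquo A B p.
Proof.
  intros (A1 & AM & AI) [(B1 & BM & BI) BN] HBA.
  set (nf := fun x => epsilon (inhabits x) (fun z => B (x^-1 * z))).
  assert (nf_spec : forall x, B (x^-1 * nf x)).
  { intros x. unfold nf. apply epsilon_spec. exists x. now rewrite mulVg. }
  assert (nf_eq : forall x y, B (x^-1 * y) -> nf x = nf y).
  { intros x y Hxy. unfold nf.
    assert (E : (fun z => B (x^-1 * z)) = (fun z => B (y^-1 * z))).
    { extensionality z. apply propositional_extensionality. split; intros Hz.
      - replace (y^-1 * z) with ((x^-1 * y)^-1 * (x^-1 * z)) by word. auto.
      - replace (x^-1 * z) with ((x^-1 * y) * (y^-1 * z)) by word. auto. }
    rewrite E. generalize (inhabits x) (inhabits y). intros h h'.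
    now rewrite (proof_irrelevance _ h h'). }
  assert (nf_sym : forall x y, B (x^-1 * y) -> B (y^-1 * x)).
  { intros x y Hxy. replace (y^-1 * x) with ((x^-1 * y)^-1) by word. auto. }
  assert (nf_inj : forall x y, nf x = nf y -> B (x^-1 * y)).
  { intros x y E. replace (x^-1 * y) with ((x^-1 * nf x) * (y^-1 * nf y)^-1).
    - auto.
    - rewrite E. word. }
  assert (nf_A : forall x, A x -> A (nf x)).
  { intros x Hx. replace (nf x) with (x * (x^-1 * nf x)) by word. auto. }
  assert (nf_nf : forall x, nf (nf x) = nf x).
  { intros x. symmetry. apply nf_eq, nf_spec. }
  assert (nf_mul : forall x y, nf (nf x * nf y) = nf (x * y)).
  { intros x y. symmetry. apply nf_eq.
    replace ((x * y)^-1 * (nf x * nf y))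
      with ((y^-1 * ((x^-1 * nf x) * y)) * (y^-1 * nf y)) by word. auto. }
  assert (nf_inv : forall x, nf ((nf x)^-1) = nf (x^-1)).
  { intros x. symmetry. apply nf_eq.
    replace (x^-1^-1 * (nf x)^-1) with ((x^-1)^-1 * ((x^-1 * nf x)^-1 * x^-1)) by word. auto. }
  set (T := {r : G | A r /\ nf r = r}).
  set (cls := fun a (Ha : A a) => exist (fun r => A r /\ nf r = r) (nf a) (conj (nf_A a Ha) (nf_nf a)) : T).
  assert (val_inj : forall x y : T, proj1_sig x = proj1_sig y -> x = y).
  { intros [x Hx] [y Hy]. simpl. intros ->. f_equal. apply proof_irrelevance. }
  assert (HA : forall x : T, A (proj1_sig x)) by (intros [x []]; auto).
  assert (Hnf : forall x : T, nf (proj1_sig x) = proj1_sig x) by (intros [x []]; auto).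
  unshelve eset (Q := {| carrier := T;
      gmul := fun x y => cls (proj1_sig x * proj1_sig y) (AM _ _ (HA x) (HA y));
      ginv := fun x => cls ((proj1_sig x)^-1) (AI _ (HA x));
      gone := cls 1 A1 |}).
  - intros x y z. apply val_inj. simpl.
    rewrite <- (Hnf x) at 1. rewrite <- (Hnf z) at 2. rewrite !nf_mul. f_equal. word.
  - intros x. apply val_inj. simpl. rewrite <- (Hnf x) at 1. rewrite nf_mul. rewrite mul1g. auto.
  - intros x. apply val_inj. simpl. rewrite <- (Hnf x) at 1. rewrite nf_mul. rewrite mulg1. auto.
  - intros x. apply val_inj. simpl. rewrite <- (Hnf x) at 2. rewrite nf_mul. now rewrite mulVg.
  - intros x. apply val_inj. simpl. rewrite <- (Hnf x) at 1. rewrite nf_mul. now rewrite mulgV.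
  - set (p := fun a => match excluded_middle_informative (A a) with
                       | left Ha => cls a Ha | right _ => cls 1 A1 end).
    assert (Hp : forall a, A a -> proj1_sig (p a) = nf a).
    { intros a Ha. unfold p. destruct excluded_middle_informative; [reflexivity | tauto]. }
    exists Q, p. repeat split.
    + intros a b Ha Hb. apply val_inj. rewrite Hp by auto. simpl.
      now rewrite (Hp a Ha), (Hp b Hb), nf_mul.
    + intros E. apply nf_inj. rewrite <- !Hp by auto. now rewrite E.
    + intros E. apply val_inj. rewrite !Hp by auto. now apply nf_eq.
    + intros x. exists (proj1_sig x). split; [apply HA|]. apply val_inj.
      rewrite Hp; [apply Hnf | apply HA].
Qed.

Section Formulas.
Variables (G : Group) (i n : nat) (y : nat -> G).
Local Notation A := (ucs (S (S i))).
Local Notation B := (ucs (S i)).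
Local Notation C := (ucs i).

(* With L = Z_{i+2}/Z_{i+1}, the tuple [v] encodes the partial map m of L determined by
   [m(a), y j] = [a, v j] modulo Z_i, and [enc_graph v] is its graph. *)
Definition enc_graph (v : nat -> G) (a b : G) : Prop :=
  A b /\ forall j, j < n -> C ((comm b (y j))^-1 * comm a (v j)).

Definition enc_total (v : nat -> G) : Prop := forall a, A a -> exists b, enc_graph v a b.

(** Centrality is expressed on graphs: with b = m_v(a), c = m_w(b) and d = m_w(a), the conclusion is
    m_v(d) = c. *)
Definition enc_scalar (v : nat -> G) : Prop :=
  enc_total v /\ forall w, enc_total w -> forall a b c d, A a ->
    enc_graph v a b -> enc_graph w b c -> enc_graph w a d -> enc_graph v d c.

Fixpoint enc_span (l : list G) (a : G) : Prop :=
  match l with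
  | [] => B a
  | a1 :: l => exists v, enc_scalar v /\ exists b, enc_graph v a1 b /\ enc_span l (b^-1 * a)
  end.

Fixpoint enc_eval (ks : list Z) (v : nat -> G) (a c : G) : Prop :=
  match ks with
  | [] => B (a^-1 * c)
  | k :: ks => exists c', A c' /\ enc_eval ks v a c' /\
      exists d, enc_graph v c' d /\ B ((zpow a k * d)^-1 * c)
  end.

(** This condition and [enc_adj] are automatic when y generates the group. They enter the formula
    because in H the corresponding tuple is not known to generate. *)
Definition enc_nondeg : Prop := forall a, A a -> (forall j, j < n -> C (comm a (y j))) -> B a.

Definition enc_adj : Prop := forall v, enc_total v -> forall g, exists u, forall a b, A a ->
  enc_graph v a b -> C ((comm b g)^-1 * comm a u).

Lemma enc_graph_ext v w : (forall j, j < n -> v j = w j) -> enc_graph v = enc_graph w.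
Proof.
  intros E. extensionality a. extensionality b. apply propositional_extensionality.
  split; intros [Hb H]; split; auto; intros j Hj; specialize (H j Hj).
  - now rewrite <- E.
  - now rewrite E.
Qed.

Lemma enc_eval_ext ks v w : (forall j, j < n -> v j = w j) -> forall a c, enc_eval ks v a c -> enc_eval ks w a c.
Proof.
  intros E. induction ks as [|k ks IH]; simpl; auto.
  intros a c (c' & Hc' & H1 & d & Hd & H2). exists c'. split; auto. split; auto.
  exists d. rewrite <- (enc_graph_ext v w E). auto.
Qed.

Lemma enc_total_ext v w : (forall j, j < n -> v j = w j) -> enc_total v -> enc_total w.
Proof. intros E. unfold enc_total. now rewrite (enc_graph_ext v w E). Qed.

Lemma enc_scalar_ext v w : (forall j, j < n -> v j = w j) -> enc_scalar v -> enc_scalar w.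
Proof. intros E. unfold enc_scalar, enc_total. now rewrite (enc_graph_ext v w E). Qed.
End Formulas.

(* The first entry of a stage is the next module generator, the second one lists the values
   of the finitely many roots on it. *)
Fixpoint enc_cover (G : Group) (i n : nat) (e : nat -> G) (ps : list (list Z))
    (st : list (term * list term)) : Prop :=
  match st with
  | [] => True
  | (ta, tws) :: st' =>
      ucs (S (S i)) (teval G e ta) /\
      (forall ks, In ks ps -> forall v, enc_scalar G i n e v -> forall c, ucs (S (S i)) c ->
         enc_eval G i n e ks v (teval G e ta) c ->
         enc_span G i n e (map (fun s => teval G e (fst s)) st') c ->
         exists tw, In tw tws /\ ucs (S (S i)) (teval G e tw) /\
           exists b, enc_graph G i n e v (teval G e ta) b /\
             enc_span G i n e (map (fun s => teval G e (fst s)) st') ((teval G e tw)^-1 * b)) /\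
      enc_cover G i n e ps st'
  end.

Definition section_formula (G : Group) (i n : nat) (e : nat -> G) (ps : list (list Z))
    (st : list (term * list term)) : Prop :=
  enc_nondeg G i n e /\ enc_adj G i n e /\ enc_cover G i n e ps st /\
  forall a, ucs (S (S i)) a -> enc_span G i n e (map (fun s => teval G e (fst s)) st) a.

(** * Definability of the encoded notions *)

Section Definability.
Variables i n : nat.

Definition is_term_seq (Y : forall G : Group, (nat -> G) -> nat -> G) : Prop :=
  forall j, is_term (fun G e => Y G e j).

Lemma is_term_seq_sub Y s : is_term_seq Y -> is_term_seq (fun G e => Y G (fun k => e (s k))).
Proof. intros HY j. apply (is_term_sub _ s (HY j)). Qed.
Lemma is_term_seq_var s : is_term_seq (fun G e j => e (s j)).
Proof. intros j. apply is_term_var. Qed.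

Ltac tms := solve [ assumption | apply is_term_seq_var | apply (is_term_seq_var (fun j => j))
  | match goal with H : is_term_seq ?Y |- _ => apply (is_term_seq_sub Y _ H) end ].

Lemma definable_enc_graph Y V X X' : is_term_seq Y -> is_term_seq V -> is_term X -> is_term X' ->
  definable (fun G e => enc_graph G i n (Y G e) (V G e) (X G e) (X' G e)).
Proof.
  intros HY HV HX HX'. apply definable_and; [now apply definable_ucs|].
  apply definable_lt. intros j. apply definable_ucs.
  apply is_term_mul; [apply is_term_inv|]; apply is_term_comm; auto.
Qed.

Lemma definable_enc_total Y V : is_term_seq Y -> is_term_seq V -> definable (fun G e => enc_total G i n (Y G e) (V G e)).
Proof.
  intros HY HV. apply definable_all, definable_imp; [apply definable_ucs; tm|].
  apply definable_ex, definable_enc_graph; first [tms | tm].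
Qed.

Lemma definable_enc_scalar Y V : is_term_seq Y -> is_term_seq V -> definable (fun G e => enc_scalar G i n (Y G e) (V G e)).
Proof.
  intros HY HV. apply definable_and; [now apply definable_enc_total|].
  apply (definable_allt n).
  { intros G e v w E. rewrite (enc_graph_ext G i n (Y G e) v w E). intros H Hw. apply H.
    revert Hw. apply enc_total_ext. intros. symmetry. auto. }
  apply definable_imp; [apply definable_enc_total; tms|].
  apply definable_all, definable_all, definable_all, definable_all, definable_imp; [apply definable_ucs; tm|].
  apply definable_imp; [apply definable_enc_graph; first [tms | tm]|].
  apply definable_imp; [apply definable_enc_graph; first [tms | tm]|].
  apply definable_imp; apply definable_enc_graph; first [tms | tm].
Qed.

(** The renaming r records how far the quantifiers passed so far have shifted the environment in
    which the words of [l] are evaluated. *)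
Lemma definable_enc_span (l : list term) r : forall Y X, is_term_seq Y -> is_term X ->
  definable (fun G e => enc_span G i n (Y G e) (map (teval G (fun k => e (r k))) l) (X G e)).
Proof.
  revert r. induction l as [|t l IH]; intros r Y X HY HX; cbn [map enc_span].
  - now apply definable_ucs.
  - apply (definable_ext_t n).
    { intros G e v w E (Hv & b & Hb). split; [revert Hv; now apply enc_scalar_ext|].
      exists b. now rewrite <- (enc_graph_ext G i n (Y G e) v w E). }
    apply definable_and; [apply definable_enc_scalar; tms|]. apply definable_ex, definable_and.
    + apply definable_enc_graph; first [tms | apply (is_term_sub _ (fun k => S (n + r k)) (is_term_teval t))].
    + apply (IH (fun k => S (n + r k)) (fun G e => Y G (fun k => e (S (n + k))))); [tms|].
      apply is_term_mul; [tm|]. apply (is_term_sub X (fun k => S (n + k)) HX).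
Qed.

Lemma definable_enc_eval ks : forall Y V X X', is_term_seq Y -> is_term_seq V -> is_term X -> is_term X' ->
  definable (fun G e => enc_eval G i n (Y G e) ks (V G e) (X G e) (X' G e)).
Proof.
  induction ks as [|k ks IH]; intros Y V X X' HY HV HX HX'; cbn [enc_eval].
  - apply definable_ucs, is_term_mul; auto. now apply is_term_inv.
  - apply definable_ex, definable_and; [apply definable_ucs; tm|]. apply definable_and.
    + apply (IH (fun G e => Y G (fun k => e (S k))) (fun G e => V G (fun k => e (S k)))
       (fun G e => X G (fun k => e (S k)))); first [tms | apply (is_term_sub X S HX) | tm].
    + apply definable_ex, definable_and; [apply definable_enc_graph; first [tms | tm]|].
      apply definable_ucs, is_term_mul; [apply is_term_inv, is_term_mul; [apply is_term_zpow|tm]|].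
      * apply (is_term_sub X (fun k => S (S k)) HX).
      * apply (is_term_sub X' (fun k => S (S k)) HX').
Qed.

Lemma definable_enc_cover ps st : definable (fun G e => enc_cover G i n e ps st).
Proof.
  assert (Hmap : forall (G : Group) (e : nat -> G) (l : list (term * list term)),
    map (fun s => teval G e (fst s)) l = map (teval G e) (map fst l)).
  { intros. now rewrite map_map. }
  induction st as [|[ta tws] st IH]; cbn [enc_cover]; [apply definable_True|].
  apply definable_and; [apply definable_ucs, is_term_teval | apply definable_and; [|exact IH]].
  apply definable_forall_in. intros ks. apply (definable_allt n).
  { intros G e v w E H Hw c Hc Hp Hf.
    destruct (H (enc_scalar_ext G i n e w v (fun j Hj => eq_sym (E j Hj)) Hw) c Hc
      (enc_eval_ext G i n e ks w v (fun j Hj => eq_sym (E j Hj)) _ _ Hp) Hf)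
      as (tw & H1 & H2 & b & H3 & H4).
    exists tw. split; auto. split; auto. exists b.
    now rewrite <- (enc_graph_ext G i n e v w E). }
  assert (Ht : forall s t, is_term (fun G e => teval G (fun k => e (s k)) t)).
  { intros s t. apply (is_term_sub _ s (is_term_teval t)). }
  apply definable_imp; [apply definable_enc_scalar; tms|].
  apply definable_all, definable_imp; [apply definable_ucs; tm|].
  apply definable_imp; [apply definable_enc_eval; first [tms | apply (Ht (fun k => S (n + k)))]|].
  apply definable_imp.
  { apply (definable_ext (fun G e => enc_span G i n (fun k => e (S (n + k)))
      (map (teval G (fun k => e (S (n + k)))) (map fst st)) (e 0))).
    - intros. now rewrite Hmap.
    - apply (definable_enc_span (map fst st) (fun k => S (n + k)) (fun G e k => e (S (n + k)))); first [tms | tm]. }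
  apply definable_exists_in. intros tw. apply definable_and; [apply definable_ucs, (Ht (fun k => S (n + k)))|].
  apply definable_ex, definable_and.
  - apply definable_enc_graph; first [tms | apply (Ht (fun k => S (S (n + k))))].
  - apply (definable_ext (fun G e => enc_span G i n (fun k => e (S (S (n + k))))
      (map (teval G (fun k => e (S (S (n + k))))) (map fst st))
      ((teval G (fun k => e (S (S (n + k)))) tw)^-1 * e 0))).
    + intros. now rewrite Hmap.
    + apply (definable_enc_span (map fst st) (fun k => S (S (n + k))) (fun G e k => e (S (S (n + k))))); [tms|].
      apply is_term_mul; [apply is_term_inv, (Ht (fun k => S (S (n + k)))) | tm].
Qed.

Lemma definable_section_formula ps st : definable (fun G e => section_formula G i n e ps st).
Proof.
  apply definable_and; [|apply definable_and; [|apply definable_and; [apply definable_enc_cover|]]].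
  - apply definable_all, definable_imp; [apply definable_ucs; tm|]. apply definable_imp; [|apply definable_ucs; tm].
    apply definable_lt. intros j. apply definable_ucs. tm.
  - apply (definable_allt n).
    { intros G e v w E H Hw. rewrite <- (enc_graph_ext G i n e v w E). apply H.
      revert Hw. apply enc_total_ext. intros. symmetry. auto. }
    apply definable_imp; [apply definable_enc_total; tms|].
    apply definable_all, definable_ex, definable_all, definable_all, definable_imp; [apply definable_ucs; tm|].
    apply definable_imp; [apply definable_enc_graph; first [tms | tm] | apply definable_ucs; tm].
  - apply definable_all, definable_imp; [apply definable_ucs; tm|].
    apply (definable_ext (fun G e => enc_span G i n (fun k => e (S k))
      (map (teval G (fun k => e (S k))) (map fst st)) (e 0))).
    + intros. now rewrite map_map.
    + apply (definable_enc_span (map fst st) S (fun G e k => e (S k))); first [tms | tm].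
Qed.

End Definability.

(** * Generation modulo the next term of the upper central series *)

Section SubquoFacts.
Variables (G Q : Group) (A B : G -> Prop) (p : G -> Q).
Hypotheses (HA : subgroup A) (Hp : subquo A B p).

Lemma subquo_mul a b : A a -> A b -> p (a * b) = p a * p b.
Proof. apply Hp. Qed.
Lemma subquo_1 : p 1 = 1.
Proof.
  apply (mul_cancel_l _ (p 1)). rewrite <- subquo_mul by apply HA. now rewrite !mulg1.
Qed.
Lemma subquo_inv a : A a -> p (a^-1) = (p a)^-1.
Proof.
  intros Ha. apply inv_uniq. rewrite <- subquo_mul, mulgV; auto using subquo_1. now apply HA.
Qed.
Lemma subquo_zpow a k : A a -> p (zpow a k) = zpow (p a) k.
Proof.
  intros Ha. induction k using Z.peano_ind; [apply subquo_1 | |].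
  - rewrite !zpow_succ, subquo_mul, IHk; auto. now apply subgroup_zpow.
  - rewrite !zpow_pred, subquo_mul, IHk, subquo_inv; auto; [now apply subgroup_zpow | now apply HA].
Qed.
Lemma subquo_eq a b : A a -> A b -> (p a = p b <-> B (a^-1 * b)).
Proof. apply Hp. Qed.
Lemma subquo_ker a : A a -> (p a = 1 <-> B a).
Proof.
  intros Ha. rewrite <- subquo_1. assert (H1 : A 1) by apply HA.
  replace (B a) with (B (1^-1 * a)) by (f_equal; word).
  rewrite <- subquo_eq by auto. split; congruence.
Qed.
Lemma subquo_surj x : exists a, A a /\ p a = x.
Proof. apply Hp. Qed.
End SubquoFacts.

(** * Agreement of the encoding with the scalars of the commutator pairing *)

Section Bridge.
Variables (G L M : Group) (i n : nat) (p : G -> L) (q : G -> M).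
Local Notation A := (ucs (G := G) (S (S i))).
Local Notation B := (ucs (G := G) (S i)).
Local Notation C := (ucs (G := G) i).
Hypothesis Hp : subquo A B p.
Hypothesis Hq : subquo (fun _ => True) C q.

Let HA : subgroup A := ucs_subgroup G (S (S i)).
Let HT : subgroup (fun _ : G => True).
Proof. repeat split. Qed.
Let AM a b : A a -> A b -> A (a * b). Proof. apply HA. Qed.
Let AI a : A a -> A (a^-1). Proof. apply HA. Qed.

Let qM a b : q (a * b) = q a * q b. Proof. now apply (subquo_mul _ _ _ _ _ Hq). Qed.
Let q1 : q 1 = 1. Proof. now apply (subquo_1 _ _ _ _ _ HT Hq). Qed.
Let qK a : q a = 1 <-> C a. Proof. now apply (subquo_ker _ _ _ _ _ HT Hq). Qed.
Let qE a b : q a = q b <-> C (a^-1 * b). Proof. now apply (subquo_eq _ _ _ _ _ Hq). Qed.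

Let qcomm a g : B a -> q (comm a g) = 1.
Proof. intros Ha. now apply qK. Qed.

(** The correcting factor is a commutator with [a, g], an element of Z_{i+1}, and so vanishes modulo
    Z_i. *)
Let qcomm_mull a b g : A a -> q (comm (a * b) g) = q (comm a g) * q (comm b g).
Proof.
  intros Ha.
  replace (comm (a * b) g) with (comm a g * comm (comm a g) b * comm b g) by word.
  rewrite !qM, (qcomm (comm a g)); [word | exact (Ha g)].
Qed.

Let qcomm_mulr a g h : A a -> q (comm a (g * h)) = q (comm a g) * q (comm a h).
Proof.
  intros Ha.
  replace (comm a (g * h)) with (comm a g * comm a h * comm (comm a h) (comm a g) * comm (comm a g) h).
  - rewrite !qM, !(qcomm (comm a _)); [word | exact (Ha _) | exact (Ha _)].
  - replace (comm a (g * h)) with (comm a h * comm a g * comm (comm a g) h) by word.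
    f_equal. unfold comm at 3. word.
Qed.

Lemma exists_rep : exists r : L -> G, forall x, A (r x) /\ p (r x) = x.
Proof.
  exists (fun x => proj1_sig (constructive_indefinite_description _ (subquo_surj _ _ _ _ _ Hp x))).
  intros x. now destruct constructive_indefinite_description.
Qed.

Definition pairing_on (f : L -> G -> M) : Prop :=
  forall a g, A a -> f (p a) g = q (comm a g).

Lemma exists_pairing : exists f, pairing_on f.
Proof.
  destruct exists_rep as [r Hr]. exists (fun x g => q (comm (r x) g)). intros a g Ha.
  destruct (Hr (p a)) as [H1 H2]. apply (subquo_eq _ _ _ _ _ Hp) in H2; auto.
  replace a with (r (p a) * ((r (p a))^-1 * a)) at 2 by word.
  now rewrite qcomm_mull, (qcomm (_^-1 * _)), mulg1.
Qed.

Variable f : L -> G -> M.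
Hypothesis Hf : pairing_on f.

Lemma pairing_mull x y g : f (x * y) g = f x g * f y g.
Proof.
  destruct (subquo_surj _ _ _ _ _ Hp x) as (a & Ha & <-), (subquo_surj _ _ _ _ _ Hp y) as (b & Hb & <-).
  rewrite <- (subquo_mul _ _ _ _ _ Hp), !Hf by auto. now apply qcomm_mull.
Qed.

Lemma pairing_mulr x g h : f x (g * h) = f x g * f x h.
Proof.
  destruct (subquo_surj _ _ _ _ _ Hp x) as (a & Ha & <-). rewrite !Hf by auto. now apply qcomm_mulr.
Qed.

Lemma pairing_nondeg x : (forall g, f x g = 1) -> x = 1.
Proof.
  destruct (subquo_surj _ _ _ _ _ Hp x) as (a & Ha & <-). intros H.
  apply (subquo_ker _ _ _ _ _ HA Hp); auto. intros g. apply qK. now rewrite <- Hf.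
Qed.

Lemma subquo_comm (x y : L) : x * y = y * x.
Proof.
  destruct (subquo_surj _ _ _ _ _ Hp x) as (a & Ha & <-), (subquo_surj _ _ _ _ _ Hp y) as (b & Hb & <-).
  rewrite <- !(subquo_mul _ _ _ _ _ Hp) by auto. symmetry.
  apply (subquo_eq _ _ _ _ _ Hp); auto.
  replace ((b * a)^-1 * (a * b)) with (comm a b) by word. exact (Ha b).
Qed.

Variable y : nat -> G.
Hypothesis Hnd : enc_nondeg G i n y.
Hypothesis Hadj : enc_adj G i n y.
Local Notation enc_graph := (enc_graph G i n y).
Local Notation enc_total := (enc_total G i n y).
Local Notation enc_scalar := (enc_scalar G i n y).
Local Notation enc_span := (enc_span G i n y).
Local Notation enc_eval := (enc_eval G i n y).

Let inj x z : (forall j, j < n -> f x (y j) = f z (y j)) -> x = z.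
Proof.
  destruct (subquo_surj _ _ _ _ _ Hp x) as (a & Ha & <-), (subquo_surj _ _ _ _ _ Hp z) as (b & Hb & <-).
  intros H. apply (subquo_eq _ _ _ _ _ Hp); auto. apply Hnd; auto. intros j Hj. apply qK.
  rewrite qcomm_mull by auto. specialize (H j Hj). rewrite !Hf in H by auto. rewrite <- H.
  rewrite <- qcomm_mull, mulVg by auto. replace (comm 1 (y j)) with (1:G) by word. auto.
Qed.

Lemma enc_graph_iff v a b : A a -> A b ->
  (enc_graph v a b <-> forall j, j < n -> f (p b) (y j) = f (p a) (v j)).
Proof.
  intros Ha Hb. split.
  - intros [_ H] j Hj. rewrite !Hf by auto. now apply qE, H.
  - intros H. split; auto. intros j Hj. apply qE. rewrite <- !Hf; auto.
Qed.

Definition encodes (v : nat -> G) (m : L -> L) : Prop :=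
  forall a b, A a -> A b -> (enc_graph v a b <-> m (p a) = p b).

Lemma enc_total_encodes v : enc_total v -> exists m, adjointable G L M f m /\ encodes v m.
Proof.
  intros Hv.
  assert (Hex : forall x, exists z, forall j, j < n -> f z (y j) = f x (v j)).
  { intros x. destruct (subquo_surj _ _ _ _ _ Hp x) as (a & Ha & <-).
    destruct (Hv a Ha) as [b Hb]. exists (p b). apply enc_graph_iff; auto. apply Hb. }
  set (m := fun x => proj1_sig (constructive_indefinite_description _ (Hex x))).
  assert (Hm : forall x j, j < n -> f (m x) (y j) = f x (v j)).
  { intros x. unfold m. now destruct constructive_indefinite_description. }
  assert (He : encodes v m).
  { intros a b Ha Hb. rewrite enc_graph_iff by auto. split.
    - intros H. apply inj. intros j Hj. rewrite Hm, H; auto.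
    - intros <- j Hj. auto. }
  exists m. split; auto. intros g. destruct (Hadj v Hv g) as [u Hu]. exists u. intros x.
  destruct (subquo_surj _ _ _ _ _ Hp x) as (a & Ha & <-).
  destruct (subquo_surj _ _ _ _ _ Hp (m (p a))) as (b & Hb & E).
  rewrite <- E, !Hf by auto. apply qE, Hu; auto. now apply He.
Qed.

Lemma adjointable_encoded m : adjointable G L M f m -> exists v, enc_total v /\ encodes v m.
Proof.
  intros Hm.
  set (v := fun j => proj1_sig (constructive_indefinite_description _ (Hm (y j)))).
  assert (Hv : forall j x, f (m x) (y j) = f x (v j)).
  { intros j. unfold v. now destruct constructive_indefinite_description. }
  assert (He : encodes v m).
  { intros a b Ha Hb. rewrite enc_graph_iff by auto. split.
    - intros H. apply inj. intros j Hj. rewrite Hv, H; auto.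
    - intros <- j Hj. auto. }
  exists v. split; auto. intros a Ha.
  destruct (subquo_surj _ _ _ _ _ Hp (m (p a))) as (b & Hb & E). exists b. now apply He.
Qed.

(** Tuples that encode total maps represent exactly the adjointable maps, so commuting with every
    encoded map is commuting with every adjointable one. *)
Lemma enc_scalar_encodes v : enc_scalar v -> exists m, scalar G L M f m /\ encodes v m.
Proof.
  intros [Hv Hc]. destruct (enc_total_encodes v Hv) as (m & Hm & He). exists m. split; auto.
  split; auto. intros m' Hm' x. destruct (adjointable_encoded m' Hm') as (w & Hw & He').
  destruct (subquo_surj _ _ _ _ _ Hp x) as (a & Ha & <-).
  destruct (subquo_surj _ _ _ _ _ Hp (m (p a))) as (b & Hb & Eb).
  destruct (subquo_surj _ _ _ _ _ Hp (m' (p b))) as (c & Hcc & Ec).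
  destruct (subquo_surj _ _ _ _ _ Hp (m' (p a))) as (d & Hd & Ed).
  rewrite <- Eb, <- Ed, <- Ec. apply He; auto.
  apply (Hc w Hw a b c d); auto; [apply He | apply He' | apply He']; auto.
Qed.

Lemma scalar_encoded m : scalar G L M f m -> exists v, enc_scalar v /\ encodes v m.
Proof.
  intros [Hm Hc]. destruct (adjointable_encoded m Hm) as (v & Hv & He). exists v. split; auto.
  split; auto. intros w Hw a b c d Ha Hab Hbc Had.
  destruct (enc_total_encodes w Hw) as (m' & Hm' & He').
  assert (Hb : A b) by apply Hab. assert (Hcc : A c) by apply Hbc. assert (Hd : A d) by apply Had.
  apply He in Hab; auto. apply He' in Hbc; auto. apply He' in Had; auto.
  apply He; auto. rewrite <- Had, <- Hbc, <- Hab. now apply Hc.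
Qed.

Lemma enc_span_iff l : (forall c, In c l -> A c) -> forall a, A a ->
  (enc_span l a <-> span G L M f (map p l) (p a)).
Proof.
  induction l as [|c l IH]; intros Hl a Ha; simpl.
  - symmetry. now apply (subquo_ker _ _ _ _ _ HA Hp).
  - assert (Hc : A c) by (apply Hl; now left).
    assert (IH' : forall a, A a -> enc_span l a <-> span G L M f (map p l) (p a)).
    { apply IH. intros; apply Hl; now right. }
    assert (E : forall b, A b -> p (b^-1 * a) = (p b)^-1 * p a).
    { intros b Hb. rewrite (subquo_mul _ _ _ _ _ Hp), (subquo_inv _ _ _ _ _ HA Hp); auto. }
    split.
    + intros (v & Hv & b & Hcb & H). destruct (enc_scalar_encodes v Hv) as (m & Hm & He).
      assert (Hb : A b) by apply Hcb. exists m. split; auto.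
      apply He in Hcb; auto. rewrite Hcb, <- E by auto. apply IH'; auto.
    + intros (m & Hm & H). destruct (scalar_encoded m Hm) as (v & Hv & He).
      exists v. split; auto. destruct (subquo_surj _ _ _ _ _ Hp (m (p c))) as (b & Hb & Eb).
      exists b. split; [now apply He|]. apply IH'; auto. rewrite E, Eb; auto.
Qed.

Lemma enc_eval_iff ks v m : encodes v m -> forall a c, A a -> A c ->
  (enc_eval ks v a c <-> heval L (map (zscalar L) ks) m (p a) = p c).
Proof.
  intros He. induction ks as [|k ks IH]; intros a c Ha Hc.
  - simpl. symmetry. now apply (subquo_eq _ _ _ _ _ Hp).
  - assert (Hk : A (zpow a k)) by now apply subgroup_zpow.
    change (heval L (map (zscalar L) (k :: ks)) m (p a))
      with (zpow (p a) k * m (heval L (map (zscalar L) ks) m (p a))).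
    assert (E : forall d, A d -> (zpow (p a) k * p d = p c <-> B ((zpow a k * d)^-1 * c))).
    { intros d Hd. rewrite <- (subquo_zpow _ _ _ _ _ HA Hp), <- (subquo_mul _ _ _ _ _ Hp) by auto.
      apply (subquo_eq _ _ _ _ _ Hp); auto. }
    split.
    + intros (c' & Hc' & H1 & d & H2 & H3). assert (Hd : A d) by apply H2.
      apply IH in H1; auto. apply He in H2; auto. rewrite H1, H2. now apply E.
    + intros H.
      destruct (subquo_surj _ _ _ _ _ Hp (heval L (map (zscalar L) ks) m (p a))) as (c' & Hc' & E').
      destruct (subquo_surj _ _ _ _ _ Hp (m (p c'))) as (d & Hd & Ed).
      exists c'. split; auto. split; [now apply IH|]. exists d. split; [now apply He|].
      apply E; auto. now rewrite Ed, E'.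
Qed.

End Bridge.

Section Generators.
Variables (G : Group) (i n : nat) (y : nat -> G).
Hypothesis Hgen : forall g, gen (range y n) g.

Lemma enc_nondeg_generators : enc_nondeg G i n y.
Proof.
  intros a Ha H g. pose proof (Hgen g) as Hg.
  destruct (ucs_normal G i) as [(C1 & CM & CI) CN].
  induction Hg as [g (j & Hj & ->)| |g h _ IHg _ IHh|g _ IHg]; auto.
  - now replace (comm a 1) with (1:G) by word.
  - replace (comm a (g * h)) with (comm a h * (h^-1 * (comm a g * h))) by word. auto.
  - replace (comm a (g^-1)) with (((g^-1)^-1 * (comm a g * g^-1))^-1) by word. auto.
Qed.

Lemma enc_adj_generators : enc_adj G i n y.
Proof.
  destruct (exists_subquo G (fun _ => True) (ucs i)) as (M & q & Hq);
    [repeat split | apply ucs_normal | auto |].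
  destruct (exists_subquo G (ucs (S (S i))) (ucs (S i))) as (L & p & Hp);
    [apply ucs_subgroup | apply ucs_normal | apply ucs_S |].
  destruct (exists_pairing G L M i p q Hp Hq) as [f Hf].
  assert (HfV : forall x g, f x (g^-1) = (f x g)^-1).
  { intros x g. apply (homV G M (f x)). intros u v. now apply (pairing_mulr G L M i p q Hp Hq f Hf). }
  intros v Hv g. pose proof (Hgen g) as Hg.
  assert (H : exists u, forall a b, ucs (S (S i)) a -> enc_graph G i n y v a b -> f (p b) g = f (p a) u).
  { induction Hg as [g (j & Hj & ->)| |g h _ [u Hu] _ [w Hw]|g _ [u Hu]].
    - exists (v j). intros a b Ha Hab. apply (enc_graph_iff G L M i n p q Hq f Hf y v); auto. apply Hab.
    - exists 1. intros a b _ _.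
      rewrite !(hom1 G M (f _)); auto; intros s t; now apply (pairing_mulr G L M i p q Hp Hq f Hf).
    - exists (u * w). intros a b Ha Hab.
      rewrite !(pairing_mulr G L M i p q Hp Hq f Hf), (Hu a b), (Hw a b); auto.
    - exists (u^-1). intros a b Ha Hab. rewrite !HfV, (Hu a b); auto. }
  destruct H as [u Hu]. exists u. intros a b Ha Hab.
  assert (Hb : ucs (S (S i)) b) by apply Hab.
  apply (subquo_eq _ _ _ _ _ Hq); auto. rewrite <- !Hf by auto. now apply Hu.
Qed.
End Generators.

Lemma section_noeth (G L : Group) i (p : G -> L) :
  subquo (ucs (S (S i))) (ucs (S i)) p -> noeth G -> noeth L.
Proof.
  intros Hp HG. apply (noeth_image p (ucs (S (S i)))); [apply ucs_subgroup | | apply Hp | apply Hp].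
  intros P HP _. now apply HG.
Qed.

(** The order of choices matters: the polynomials come from the scalars of H, then the stages and
    root values for these polynomials come from G and are written as words in y. In H the same
    words, evaluated at e, lie in the subgroup generated by e, and [cover_generates] applies. *)
Lemma core_formula (G H : Group) (i n : nat) (y : nat -> G) :
  noeth G -> noeth H -> (forall g, gen (range y n) g) ->
  exists ps st, section_formula G i n y ps st /\
    forall e : nat -> H, section_formula H i n e ps st ->
    forall a, ucs (S (S i)) a -> exists x, gen (range e n) x /\ ucs (S i) (x^-1 * a).
Proof.
  intros HG HH Hgen.
  destruct (exists_subquo H (fun _ => True) (ucs i)) as (M' & q' & Hq');
    [repeat split | apply ucs_normal | auto |].
  destruct (exists_subquo H (ucs (S (S i))) (ucs (S i))) as (L' & p' & Hp');
    [apply ucs_subgroup | apply ucs_normal | apply ucs_S |].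
  destruct (exists_pairing H L' M' i p' q' Hp' Hq') as [f' Hf'].
  destruct (exists_annihilating H L' M' f' (pairing_mull H L' M' i p' q' Hp' Hq' f' Hf')
    (pairing_mulr H L' M' i p' q' Hp' Hq' f' Hf') (pairing_nondeg H L' M' i p' q' Hp' Hq' f' Hf')
    (subquo_comm H L' i p' Hp') (section_noeth H L' i p' Hp' HH)) as [ps Hps].
  destruct (exists_subquo G (fun _ => True) (ucs i)) as (M & q & Hq);
    [repeat split | apply ucs_normal | auto |].
  destruct (exists_subquo G (ucs (S (S i))) (ucs (S i))) as (L & p & Hp);
    [apply ucs_subgroup | apply ucs_normal | apply ucs_S |].
  destruct (exists_pairing G L M i p q Hp Hq) as [f Hf].
  destruct (exists_cover G L M f (pairing_mull G L M i p q Hp Hq f Hf)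
    (pairing_mulr G L M i p q Hp Hq f Hf) (pairing_nondeg G L M i p q Hp Hq f Hf)
    (subquo_comm G L i p Hp) (section_noeth G L i p Hp HG) ps) as (cov & Hcov & Htot).
  pose proof (enc_nondeg_generators G i n y Hgen) as Hnd.
  pose proof (enc_adj_generators G i n y Hgen) as Hadj.
  (* Bounding the variables by n makes the value of the same word in H an element of the subgroup
     generated by the first n entries of e. *)
  assert (Hword : forall x : L, exists t, vars_lt n t /\ ucs (S (S i)) (teval G y t) /\ p (teval G y t) = x).
  { intros x. destruct (subquo_surj _ _ _ _ _ Hp x) as (a & Ha & <-).
    destruct (gen_teval G y n a (Hgen a)) as (t & Ht & <-). eauto. }
  assert (Hwords : forall l : list L, exists ts, (forall t, In t ts -> vars_lt n t) /\
    forall x, In x l -> exists t, In t ts /\ ucs (S (S i)) (teval G y t) /\ p (teval G y t) = x).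
  { induction l as [|x l (ts & H1 & H2)].
    - exists []. split; intros ? [].
    - destruct (Hword x) as (t & Ht & Ht' & Et). exists (t :: ts). split.
      + intros t' [<-|Ht'']; auto.
      + intros z [<-|Hz]; [exists t; simpl; auto|].
        destruct (H2 z Hz) as (t' & ? & ?). exists t'. simpl. auto. }
  assert (Hst : exists st, (forall s t, In s st -> In t (snd s) -> vars_lt n t) /\
    (forall s, In s st -> ucs (S (S i)) (teval G y (fst s))) /\
    map (fun s => p (teval G y (fst s))) st = map fst cov /\ enc_cover G i n y ps st).
  { clear Htot. induction cov as [|[x ws] cov IH].
    - exists []. simpl. repeat split; tauto.
    - destruct Hcov as [Hx Hcov]. destruct (IH Hcov) as (st & Hin & HA & Est & Hst).
      destruct (Hword x) as (ta & Hta & HAta & Eta). destruct (Hwords ws) as (tws & Htws & Hws).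
      assert (Emap : map p (map (fun s => teval G y (fst s)) st) = map fst cov).
      { now rewrite map_map. }
      assert (HAm : forall c, In c (map (fun s => teval G y (fst s)) st) -> ucs (S (S i)) c).
      { intros c Hc. apply in_map_iff in Hc. destruct Hc as (s & <- & Hs). auto. }
      exists ((ta, tws) :: st). split; [|split; [|split; [simpl; congruence|]]].
      + intros s t [<-|Hs] Ht; [now apply Htws | now apply (Hin s)].
      + intros s [<-|Hs]; auto.
      + split; auto. split; auto. intros ks Hks v Hv c Hc Hpe Hfin.
        destruct (enc_scalar_encodes G L M i n p q Hp Hq f Hf y Hnd Hadj v Hv) as (m & Hm & He).
        apply (enc_eval_iff G L i n p Hp y ks v m He) in Hpe; auto.
        apply (enc_span_iff G L M i n p q Hp Hq f Hf y Hnd Hadj) in Hfin; auto.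
        rewrite Emap, <- Hpe in Hfin. rewrite Eta in Hfin.
        destruct (Hx ks Hks m Hm Hfin) as (w & Hw & Hmw).
        destruct (Hws w Hw) as (tw & Htw & HAtw & Etw). exists tw. split; auto. split; auto.
        destruct (subquo_surj _ _ _ _ _ Hp (m x)) as (b & Hb & Eb). exists b. split.
        * apply He; auto. congruence.
        * assert (Htwi : ucs (S (S i)) ((teval G y tw)^-1)) by now apply ucs_subgroup.
          apply (enc_span_iff G L M i n p q Hp Hq f Hf y Hnd Hadj); auto.
          -- now apply ucs_subgroup.
          -- rewrite Emap, (subquo_mul _ _ _ _ _ Hp), (subquo_inv _ _ _ _ _ (ucs_subgroup G _) Hp), Eb, Etw; auto. }
  destruct Hst as (st & Hin & HA & Est & Hst). exists ps, st. split.
  - split; auto. split; auto. split; auto. intros a Ha.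
    apply (enc_span_iff G L M i n p q Hp Hq f Hf y Hnd Hadj); auto.
    + intros c Hc. apply in_map_iff in Hc. destruct Hc as (s & <- & Hs). auto.
    + rewrite map_map, Est. apply Htot.
  - clear Hst Est HA Hword Hwords. intros e (Hnd' & Hadj' & Hcov' & Htot').
    set (X := fun x : L' => exists a, gen (range e n) a /\ ucs (S (S i)) a /\ p' a = x).
    assert (HX : subgroup X).
    { destruct (ucs_subgroup H (S (S i))) as (A1 & AM & AI). repeat split.
      - exists 1. split; [apply gen_one|]. split; auto.
        apply (subquo_1 _ _ _ _ _ (ucs_subgroup H _) Hp').
      - intros x z (a & Ha1 & Ha2 & <-) (b & Hb1 & Hb2 & <-). exists (a * b).
        split; [now apply gen_mul|]. split; auto. now apply (subquo_mul _ _ _ _ _ Hp').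
      - intros x (a & Ha1 & Ha2 & <-). exists (a^-1).
        split; [now apply gen_inv|]. split; auto. now apply (subquo_inv _ _ _ _ _ (ucs_subgroup H _) Hp'). }
    (* The roots outside Z_{i+2} are junk, so only the others are kept. *)
    assert (Hst : exists cov', covers H L' M' f' ps cov' /\
      map fst cov' = map p' (map (fun s => teval H e (fst s)) st) /\
      (forall c, In c (map (fun s => teval H e (fst s)) st) -> ucs (S (S i)) c) /\
      forall s w, In s cov' -> In w (snd s) -> X w).
    { clear Htot'. induction st as [|[ta tws] st IH].
      - exists []. simpl. tauto.
      - destruct Hcov' as (HAta & Hx & Hcov').
        destruct IH as (cov' & H1 & H2 & H3 & H4); auto.
        { intros s t Hs. apply Hin. now right. }
        assert (Hws : exists ws, (forall w, In w ws -> X w) /\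
          forall tw, In tw tws -> ucs (S (S i)) (teval H e tw) -> In (p' (teval H e tw)) ws).
        { assert (Ht : forall t, In t tws -> vars_lt n t).
          { intros t. apply (Hin (ta, tws)). now left. }
          clear -Ht. induction tws as [|t tws IH].
          - exists []. split; [intros w [] | intros t []].
          - destruct IH as (ws & G1 & G2); [intros; apply Ht; now right|].
            destruct (classic (ucs (S (S i)) (teval H e t))) as [HA|HA].
            + exists (p' (teval H e t) :: ws). split.
              * intros w [<-|Hw]; auto. exists (teval H e t). split; auto.
                apply teval_gen, Ht. now left.
              * intros t' [<-|Ht']; simpl; auto.
            + exists ws. split; auto. intros t' [<-|Ht'] HA'; [tauto | auto]. }
        destruct Hws as (ws & HwX & Hws).
        exists ((p' (teval H e ta), ws) :: cov'). split; [|split; [simpl; congruence|split]].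
        + split; auto. rewrite H2. intros ks Hks m Hm HmL.
          destruct (scalar_encoded H L' M' i n p' q' Hp' Hq' f' Hf' e Hnd' Hadj' m Hm) as (v & Hv & He).
          destruct (subquo_surj _ _ _ _ _ Hp' (heval L' (map (zscalar L') ks) m (p' (teval H e ta)))) as (c & Hc & Ec).
          rewrite <- Ec in HmL.
          apply (enc_span_iff H L' M' i n p' q' Hp' Hq' f' Hf' e Hnd' Hadj') in HmL; auto.
          destruct (Hx ks Hks v Hv c Hc) as (tw & Htw & HAtw & b & Hab & Hfin); auto.
          { apply (enc_eval_iff H L' i n p' Hp' e ks v m He); auto. }
          assert (Hb : ucs (S (S i)) b) by apply Hab.
          assert (Htwi : ucs (S (S i)) ((teval H e tw)^-1)) by now apply ucs_subgroup.
          apply He in Hab; auto. exists (p' (teval H e tw)). split; auto.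
          apply (enc_span_iff H L' M' i n p' q' Hp' Hq' f' Hf' e Hnd' Hadj') in Hfin; auto;
            [|now apply ucs_subgroup].
          now rewrite Hab, <- (subquo_inv _ _ _ _ _ (ucs_subgroup H _) Hp'), <- (subquo_mul _ _ _ _ _ Hp') by auto.
        + intros c [<-|Hc]; auto.
        + intros s w [<-|Hs] Hw; auto. now apply (H4 s). }
    destruct Hst as (cov' & H1 & H2 & H3 & H4). intros a Ha.
    assert (HXa : X (p' a)).
    { apply (cover_generates H L' M' f' (pairing_mull H L' M' i p' q' Hp' Hq' f' Hf')
        (pairing_mulr H L' M' i p' q' Hp' Hq' f' Hf')
        (pairing_nondeg H L' M' i p' q' Hp' Hq' f' Hf') (subquo_comm H L' i p' Hp') ps cov' X); auto.
      rewrite H2. apply (enc_span_iff H L' M' i n p' q' Hp' Hq' f' Hf' e Hnd' Hadj'); auto. }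
    destruct HXa as (x & Hx & HAx & Ex). exists x. split; auto.
    now apply (subquo_eq _ _ _ _ _ Hp') in Ex.
Qed.

(** * The center, and the isomorphism *)

Section Width.
Variables (G : Group) (n : nat) (y : nat -> G).

Fixpoint comm_prod (n : nat) (u : nat -> G) : G :=
  match n with
  | 0 => 1
  | S k => comm_prod k u * comm (u k) (y k)
  end.

(** Products of k blocks [u_0, y_0] ... [u_{n-1}, y_{n-1}]: for fixed k this replaces membership in
    the commutator subgroup by a first-order condition. *)
Fixpoint width (k : nat) (x : G) : Prop :=
  match k with
  | 0 => x = 1
  | S k => exists u, width k ((comm_prod n u)^-1 * x)
  end.

Lemma comm_prod_ext k u v : (forall j, j < k -> u j = v j) -> comm_prod k u = comm_prod k v.
Proof.
  induction k; simpl; intros E; auto. rewrite IHk, E by auto. reflexivity.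
Qed.

Lemma width_sub (P : G -> Prop) : subgroup P -> (forall u j, j < n -> P (comm u (y j))) ->
  forall k x, width k x -> P x.
Proof.
  intros HP Hc. assert (Hprod : forall k u, k <= n -> P (comm_prod k u)).
  { induction k; simpl; intros u Hk; [apply HP|]. apply HP; [apply IHk | apply Hc]; lia. }
  induction k; simpl.
  - intros x ->. apply HP.
  - intros x [u Hu]. apply IHk in Hu.
    apply subgroup_ldiv in Hu; auto. apply HP, Hprod. lia.
Qed.

Hypothesis Hgen : forall g, gen (range y n) g.

(** Modulo the next term the commutators are central and bilinear, so any product of them can be
    collected into one block with a single commutator for each generator. *)
Lemma lcs_layer m x : lcs G (S m) x ->
  exists u, (forall j, lcs G m (u j)) /\ lcs G (S (S m)) ((comm_prod n u)^-1 * x).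
Proof.
  destruct (lcs_subgroup G m) as (L1 & LM & LI).
  assert (HN : normal (lcs G (S (S m)))).
  { split; [apply lcs_subgroup | intros; now apply lcs_normal]. }
  assert (HT : subgroup (fun _ : G => True)) by (repeat split).
  destruct (exists_subquo G (fun _ => True) (lcs G (S (S m))) HT HN) as (Q & q & Hq); auto.
  assert (qM : forall a b, q (a * b) = q a * q b).
  { intros. now apply (subquo_mul _ _ _ _ _ Hq). }
  assert (q1 : q 1 = 1) by apply (subquo_1 _ _ _ _ _ HT Hq).
  assert (qV : forall a, q (a^-1) = (q a)^-1).
  { intros. now apply (subquo_inv _ _ _ _ _ HT Hq). }
  assert (qK : forall a, lcs G (S (S m)) a -> q a = 1).
  { intros. now apply (subquo_ker _ _ _ _ _ HT Hq). }
  assert (qZ : forall a g, lcs G (S m) a -> q a * q g = q g * q a).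
  { intros a g Ha. rewrite <- !qM. replace (a * g) with (g * a * comm a g) by word.
    rewrite (qM (g * a)), (qK (comm a g)); [word | now apply lcs_comm]. }
  assert (qcl : forall a b g, lcs G m a -> q (comm (a * b) g) = q (comm a g) * q (comm b g)).
  { intros a b g Ha.
    replace (comm (a * b) g) with (comm a g * comm (comm a g) b * comm b g) by word.
    rewrite !qM, (qK (comm (comm a g) b)); [word | now apply lcs_comm, lcs_comm]. }
  assert (qcr : forall a g h, lcs G m a -> q (comm a (g * h)) = q (comm a g) * q (comm a h)).
  { intros a g h Ha.
    replace (comm a (g * h)) with (comm a h * comm a g * comm (comm a g) h) by word.
    rewrite !qM, (qK (comm (comm a g) h)) by now apply lcs_comm, lcs_comm.
    rewrite mulg1. apply qZ. now apply lcs_comm. }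
  assert (Hprod : forall k u v, (forall j, lcs G m (u j)) -> (forall j, lcs G m (v j)) ->
    q (comm_prod k (fun j => u j * v j)) = q (comm_prod k u) * q (comm_prod k v)).
  { intros k u v Hu Hv. induction k; simpl; [rewrite q1; word|].
    rewrite !qM, IHk, qcl by auto. rewrite !mulA. f_equal.
    rewrite !gmul_assoc. f_equal. symmetry. apply qZ. now apply lcs_comm. }
  assert (Hprod1 : forall k, comm_prod k (fun _ => 1) = 1).
  { induction k; simpl; auto. rewrite IHk. word. }
  set (T := fun z => exists u, (forall j, lcs G m (u j)) /\ q z = q (comm_prod n u)).
  assert (T1 : T 1). { exists (fun _ => 1). now rewrite Hprod1. }
  assert (TM : forall z w, T z -> T w -> T (z * w)).
  { intros z w (u & Hu & Eu) (v & Hv & Ev). exists (fun j => u j * v j). split; auto.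
    rewrite Hprod, qM by auto. congruence. }
  assert (TI : forall z, T z -> T (z^-1)).
  { intros z (u & Hu & Eu). exists (fun j => (u j)^-1). split; auto.
    rewrite qV, Eu. symmetry. apply inv_uniq. rewrite <- Hprod by auto.
    rewrite (comm_prod_ext n (fun j => u j * (u j)^-1) (fun _ => 1)).
    - now rewrite Hprod1.
    - intros. apply mulgV. }
  assert (Tc : forall a g, lcs G m a -> T (comm a g)).
  { intros a g Ha. pose proof (Hgen g) as Hg. induction Hg as [g (j & Hj & ->)| |g h _ IHg _ IHh|g _ IHg].
    - exists (fun k => if Nat.eq_dec k j then a else 1). split.
      + intros k. destruct Nat.eq_dec; auto.
      + f_equal. revert Hj. generalize n. intros n'. induction n' as [|n' IH]; [lia|].
        intros Hj. simpl. destruct (Nat.eq_dec n' j) as [->|Hne].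
        * rewrite (comm_prod_ext j _ (fun _ => 1)), Hprod1; [word|].
          intros k Hk. destruct Nat.eq_dec; [lia | auto].
        * rewrite <- IH by lia. word.
    - now replace (comm a 1) with (1:G) by word.
    - destruct (TM _ _ IHg IHh) as (u & Hu & Eu). exists u. split; auto.
      rewrite qcr, <- Eu, qM; auto.
    - destruct (TI _ IHg) as (u & Hu & Eu). exists u. split; auto.
      rewrite <- Eu, qV. apply inv_uniq. rewrite <- qcr, mulgV by auto.
      replace (comm a 1) with (1:G) by word. auto. }
  intros Hx. assert (Tx : T x).
  { revert x Hx. apply gen_min; [now repeat split|]. intros z (a & g & Ha & ->). auto. }
  destruct Tx as (u & Hu & Eu). exists u. split; auto.
  now apply (subquo_eq _ _ _ _ _ Hq).
Qed.

(** One block is spent on each layer of the lower central series, so the nilpotency bound c also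
    bounds the number of blocks. *)
Lemma lcs_width c : (forall x, lcs G c x -> x = 1) -> forall x, lcs G 1 x -> width c x.
Proof.
  intros Hc. assert (H : forall k m, m + k = c -> forall x, lcs G (S m) x -> width k x).
  { induction k; intros m Hm x Hx.
    - apply lcs_anti in Hx. apply Hc. now replace c with m by lia.
    - destruct (lcs_layer m x Hx) as (u & _ & Hu). exists u. apply (IHk (S m)); [lia | auto]. }
  intros x Hx. now apply (H c 0).
Qed.
End Width.

Lemma definable_width n c : forall Y X, is_term_seq Y -> is_term X ->
  definable (fun G e => width G n (Y G e) c (X G e)).
Proof.
  induction c as [|c IH]; intros Y X HY HX; cbn [width].
  - apply definable_eq; tm.
  - apply (definable_ext_t n).
    { intros G e v w E. now rewrite (comm_prod_ext G _ n v w E). }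
    apply (IH (fun G e => Y G (fun k => e (n + k)))
      (fun G e => (comm_prod G (Y G (fun k => e (n + k))) n (fun j => e j))^-1 *
                  X G (fun k => e (n + k)))).
    + now apply is_term_seq_sub.
    + apply is_term_mul; [apply is_term_inv | apply (is_term_sub X _ HX)].
      generalize n at 2. intros k. induction k; cbn [comm_prod]; [apply is_term_one|].
      apply is_term_mul; auto. apply is_term_comm; [apply is_term_var|].
      apply (is_term_sub (fun G e => Y G e k) _ (HY k)).
Qed.

Lemma center_subgroup (G : Group) : subgroup (ucs (G := G) 1).
Proof. apply ucs_subgroup. Qed.

Lemma center_comm (G : Group) (z x : G) : ucs 1 z -> z * x = x * z.
Proof. intros Hz. now apply center_ucs in Hz. Qed.

Lemma gpow_commute (G : Group) (x z : G) k : x * z = z * x ->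
  gpow (x * z) k = gpow x k * gpow z k.
Proof. intros E. rewrite <- !zpow_nat. now apply zpow_mul_commute. Qed.

Lemma gpow_inv (G : Group) (x : G) k : gpow (x^-1) k = (gpow x k)^-1.
Proof.
  apply inv_uniq. rewrite <- gpow_commute by word. rewrite mulgV.
  induction k; simpl; auto. rewrite IHk. word.
Qed.

Lemma gpow_1 (G : Group) k : gpow (1 : G) k = 1.
Proof. induction k; simpl; auto. rewrite IHk. word. Qed.

(** The center is finitely generated and commutative, so the product of the exponents belonging to
    its generators works for all of it. *)
Lemma center_exponent (G : Group) : noeth G ->
  (forall x, center G x -> isolator G (derived G) x) ->
  exists k, 1 <= k /\ forall z, ucs 1 z -> lcs G 1 (gpow z k).
Proof.
  intros HG HZ. destruct (HG (ucs 1) (center_subgroup G)) as [zs Hzs]; auto.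
  assert (Hzs' : forall z, In z zs -> ucs 1 z) by (intros; now apply Hzs, gen_in).
  assert (Hk : exists k, 1 <= k /\ forall z, In z zs -> lcs G 1 (gpow z k)).
  { clear Hzs. induction zs as [|z zs IH].
    - exists 1%nat. split; [lia | intros z []].
    - destruct IH as (k & Hk & IH); [intros; apply Hzs'; now right|].
      destruct (HZ z) as (m & Hm & Hzm); [apply center_ucs, Hzs'; now left|].
      exists (m * k)%nat. split; [nia|]. intros w [<-|Hw].
      + rewrite <- zpow_nat, Nat2Z.inj_mul, zpow_mul.
        apply subgroup_zpow; [apply lcs_subgroup|]. now rewrite zpow_nat.
      + rewrite <- zpow_nat, Nat2Z.inj_mul, Z.mul_comm, zpow_mul.
        apply subgroup_zpow; [apply lcs_subgroup|]. rewrite zpow_nat. auto. }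
  destruct Hk as (k & Hk & Hpow). exists k. split; auto. intros z Hz. apply Hzs in Hz.
  assert (H : ucs 1 z /\ lcs G 1 (gpow z k)); [|tauto]. revert z Hz.
  destruct (lcs_subgroup G 1) as (L1 & LM & LI), (center_subgroup G) as (Z1 & ZM & ZI).
  apply gen_min.
  - split; [|split].
    + rewrite gpow_1. auto.
    + intros a b [Ha Ha'] [Hb Hb']. split; [now apply ZM|].
      rewrite gpow_commute by (now apply center_comm). auto.
    + intros a [Ha Ha']. split; [now apply ZI|]. rewrite gpow_inv. auto.
  - intros z Hz. auto.
Qed.

Lemma finite_mod_powers (G : Group) (k : nat) (zs : list G) : 1 <= k ->
  (forall z, In z zs -> ucs 1 z) ->
  exists ws, forall z, genl zs z -> exists w t, In w ws /\ ucs 1 t /\ z = w * gpow t k.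
Proof.
  intros Hk. destruct (center_subgroup G) as (Z1 & ZM & ZI).
  induction zs as [|c zs IH]; intros Hzs.
  - exists [1]. intros z Hz. apply genl_nil in Hz. subst z. exists 1, 1.
    rewrite gpow_1. simpl. split; auto. split; auto. word.
  - destruct IH as [ws Hws]; [intros; apply Hzs; now right|].
    assert (Hc : ucs 1 c) by (apply Hzs; now left).
    (* The exponent of c is divided by k: the remainder goes into the representative and the
       quotient into the k-th power. *)
    exists (flat_map (fun r => map (fun w => gpow c r * w) ws) (seq 0 k)).
    intros z Hz. destruct (gen_cyc G (fun y => In y zs) c) with (x := z) as (m & p & Hp & ->); auto.
    { intros s Hs. split.
      - replace (c * (s * c^-1)) with s; [now apply gen_in|].
        rewrite gmul_assoc, (center_comm G c s Hc). word.
      - rewrite <- (center_comm G c s Hc), mulKg. now apply gen_in. }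
    destruct (Hws p Hp) as (w & t & Hw & Ht & ->).
    pose proof (Z.div_mod m (Z.of_nat k)). pose proof (Z.mod_pos_bound m (Z.of_nat k)).
    exists (gpow c (Z.to_nat (m mod Z.of_nat k)) * w), (zpow c (m / Z.of_nat k) * t).
    assert (Hq : ucs 1 (zpow c (m / Z.of_nat k))) by (apply (subgroup_zpow G (ucs 1)); auto; apply ucs_subgroup).
    split; [|split].
    + apply in_flat_map. exists (Z.to_nat (m mod Z.of_nat k)). split.
      * apply in_seq. lia.
      * apply (in_map (fun w => gpow c (Z.to_nat (m mod Z.of_nat k)) * w)), Hw.
    + now apply ZM.
    + rewrite gpow_commute by (now apply center_comm).
      rewrite <- !zpow_nat, <- zpow_mul, Z2Nat.id by lia.
      rewrite H at 1 by lia. rewrite Z.add_comm, zpow_add, !mulA. f_equal.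
      rewrite !gmul_assoc. f_equal. rewrite Z.mul_comm. apply center_comm.
      rewrite Z.mul_comm. apply (subgroup_zpow G (ucs 1)); auto. apply ucs_subgroup.
Qed.

Lemma words_list (G : Group) n (y : nat -> G) (ws : list G) : (forall g, gen (range y n) g) ->
  exists ts, (forall t, In t ts -> vars_lt n t) /\
    forall w, In w ws -> exists t, In t ts /\ teval G y t = w.
Proof.
  intros Hgen. induction ws as [|w ws (ts & H1 & H2)].
  - exists []. split; intros ? [].
  - destruct (gen_teval G y n w (Hgen w)) as (t & Ht & Et). exists (t :: ts). split.
    + intros t' [<-|Ht']; auto.
    + intros w' [<-|Hw']; [exists t; simpl; auto|].
      destruct (H2 w' Hw') as (t' & ? & ?). exists t'. simpl. auto.
Qed.

(** * The epimorphism from G onto H *)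

Section Epimorphism.
Variables G H : Group.
Hypothesis Gfg : fin_gen G.
Hypothesis Gnil : nilpotent G.
Hypothesis GZ : forall x, center G x -> isolator G (derived G) x.
Hypothesis Hfg : fin_gen H.
Hypothesis EH : elem_equiv G H.

Lemma transfer_nilpotent : nilpotent H.
Proof.
  destruct (nilpotent_ucs G Gnil) as [c Hc].
  destruct (transfer G H (fun G e => forall x : G, ucs c x) EH) as [_ HH].
  - apply definable_all, definable_ucs. tm.
  - exists (fun _ => 1). exact Hc.
  - exact (ucs_nilpotent H c HH).
Qed.

(** Needed to exchange the roles of G and H. The isolator condition itself is not visibly
    first-order, but its uniform version is: one exponent k and a bounded number of blocks for all
    central elements. *)
Lemma transfer_isolator : forall x, center H x -> isolator H (derived H) x.
Proof.
  pose proof (fg_nilpotent_noeth G Gfg Gnil) as HG.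
  destruct (fg_nilpotent_polycyclic G Gfg Gnil) as (l & _ & Hl).
  destruct (center_exponent G HG GZ) as (k & Hk & Hpow). destruct Gnil as [c Hc].
  destruct (transfer G H (fun G e => forall z : G, ucs 1 z -> width G (length l) e c (gpow z k)) EH)
    as [e He].
  - apply definable_all, definable_imp; [apply definable_ucs; tm|].
    apply (definable_width _ _ (fun G e j => e (S j))); [apply is_term_seq_var | tm].
  - exists (nth_env l). intros z Hz. apply lcs_width; auto. intros g. now apply genl_rng.
  - intros x Hx. apply center_ucs in Hx. exists k. split; auto.
    apply (width_sub H (length l) e) with (k := c); auto.
    + apply gen_subgroup.
    + intros u j _. now apply (lcs_comm H 0).
Qed.

Lemma exists_epimorphism : exists f : G -> H, hom f /\ forall y, exists x, f x = y.
Proof.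
  pose proof (fg_nilpotent_noeth G Gfg Gnil) as NG.
  pose proof (fg_nilpotent_noeth H Hfg transfer_nilpotent) as NH.
  destruct (fg_nilpotent_polycyclic G Gfg Gnil) as (l & Hpcl & Hl).
  set (n := length l). set (y := nth_env l).
  assert (Hgen : forall g, gen (range y n) g) by (intros g; now apply genl_rng).
  destruct (polycyclic_presented G l Hpcl) as (rel & Hrel & Hpres). fold y n in Hrel, Hpres.
  destruct (center_exponent G NG GZ) as (k & Hk & Hpow).
  destruct (NG (ucs 1) (center_subgroup G)) as [zs Hzs]; auto.
  destruct (finite_mod_powers G k zs Hk) as [ws Hws].
  { intros z Hz. now apply Hzs, gen_in. }
  destruct (words_list G n y ws Hgen) as (tws & Htws & Hwords).
  destruct (nilpotent_ucs H transfer_nilpotent) as [d Hd].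
  destruct Gnil as [c Hc].
  set (core := fun i => core_formula G H i n y NG NH Hgen).
  set (ps := fun i => proj1_sig (constructive_indefinite_description _ (core i))).
  assert (core' : forall i, exists st, section_formula G i n y (ps i) st /\
    forall e : nat -> H, section_formula H i n e (ps i) st ->
    forall a, ucs (S (S i)) a -> exists x, gen (range e n) x /\ ucs (S i) (x^-1 * a)).
  { intros i. unfold ps. now destruct constructive_indefinite_description. }
  clearbody ps. clear core.
  set (st := fun i => proj1_sig (constructive_indefinite_description _ (core' i))).
  assert (Hcore : forall i, section_formula G i n y (ps i) (st i) /\
    forall e : nat -> H, section_formula H i n e (ps i) (st i) ->
    forall a, ucs (S (S i)) a -> exists x, gen (range e n) x /\ ucs (S i) (x^-1 * a)).
  { intros i. unfold st. now destruct constructive_indefinite_description. }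
  clearbody st. clear core'.
  (* The four clauses provide, in order, the homomorphism, H = X Z(H), the inclusion of Z(H)^k in X,
     and representatives in X of Z(H) modulo Z(H)^k. Only i below d occurs, where d bounds the upper
     central series of H, so this is one formula. *)
  destruct (transfer G H (fun G e =>
    (forall w, In w rel -> teval G e w = 1) /\
    (forall i, i < d -> section_formula G i n e (ps i) (st i)) /\
    (forall z, ucs 1 z -> width G n e c (gpow z k)) /\
    (forall z, ucs 1 z -> exists tw, In tw tws /\ exists t, ucs 1 t /\
       z = teval G e tw * gpow t k)) EH) as (e & He1 & He2 & He3 & He4).
  - apply definable_and; [|apply definable_and; [|apply definable_and]].
    + apply definable_forall_in. intros w. apply definable_eq; tm.
    + apply definable_lt. intros i. apply definable_section_formula.
    + apply definable_all, definable_imp; [apply definable_ucs; tm|].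
      apply (definable_width _ _ (fun G e j => e (S j))); [apply is_term_seq_var | tm].
    + apply definable_all, definable_imp; [apply definable_ucs; tm|].
      apply definable_exists_in. intros tw. apply definable_ex, definable_and; [apply definable_ucs; tm|].
      apply definable_eq; [tm|]. apply is_term_mul; [|tm].
      apply (is_term_sub _ (fun i => S (S i)) (is_term_teval tw)).
  - exists y. split; [exact Hrel|]. split; [intros; apply Hcore|]. split.
    + intros z Hz. apply lcs_width; auto.
    + intros z Hz. apply Hzs, Hws in Hz. destruct Hz as (w & t & Hw & Ht & ->).
      destruct (Hwords w Hw) as (tw & Htw & <-). exists tw. split; auto. exists t. auto.
  - set (X := gen (range e n)).
    assert (HX : subgroup X) by apply gen_subgroup.
    assert (Hmod : forall i, i <= d -> forall x, ucs (S i) x -> exists a z, X a /\ ucs 1 z /\ x = a * z).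
    { induction i; intros Hi x Hx.
      - exists 1, x. split; [apply HX|]. split; auto. word.
      - destruct (proj2 (Hcore i) e (He2 i Hi) x Hx) as (a & Ha & Hax).
        destruct (IHi (Nat.lt_le_incl _ _ Hi) _ Hax) as (b & z & Hb & Hz & E).
        exists (a * b), z. split; [now apply HX|]. split; auto.
        rewrite mulA, <- E. word. }
    assert (Hwid : forall x, width H n e c x -> X x).
    { intros x. apply width_sub; auto. intros u j Hj.
      destruct (Hmod d (le_n d) u) as (a & z & Ha & Hz & ->); [apply ucs_S, Hd|].
      assert (HXj : X (e j)) by (apply gen_in; exists j; auto).
      replace (comm (a * z) (e j)) with (comm a (e j)).
      (* A central factor does not change a commutator, so H = X Z(H) already puts every [u, e_j]
         into X. *)
      - unfold comm. destruct HX as (X1 & XM & XI). auto.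
      - replace (comm (a * z) (e j)) with (z^-1 * (comm a (e j) * z) * comm z (e j)) by word.
        rewrite (Hz (e j)), <- (center_comm H z _ Hz). word. }
    assert (Hsurj : forall x, X x).
    { intros x. destruct (Hmod d (le_n d) x) as (a & z & Ha & Hz & ->); [apply ucs_S, Hd|].
      apply HX; auto. destruct (He4 z Hz) as (tw & Htw & t & Ht & ->).
      apply HX; [|now apply Hwid, He3]. apply teval_gen. auto. }
    specialize (Hpres H e He1).
    (* R is the graph of the epimorphism: total because y generates G, single-valued because e
       satisfies the relations, and onto because e generates H. *)
    set (R := gen (range (pairing y e) n)) in *.
    assert (HR : subgroup R) by apply gen_subgroup.
    assert (Hex : forall x, exists h, R (x, h)).
    { intros x. destruct (gen_teval G y n x (Hgen x)) as (t & Ht & <-).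
      exists (teval H e t). now apply gen_pairing. }
    assert (Huniq : forall x h h', R (x, h) -> R (x, h') -> h = h').
    { intros x h h' H1 H2. assert (E : h^-1 * h' = 1).
      { apply Hpres. replace (1 : G) with (x^-1 * x) by word.
        destruct HR as (R1 & RM & RI). exact (RM _ _ (RI _ H1) H2). }
      apply inv_uniq in E. now rewrite invK in E. }
    set (f := fun x => proj1_sig (constructive_indefinite_description _ (Hex x))).
    assert (Hf : forall x, R (x, f x)).
    { intros x. unfold f. now destruct constructive_indefinite_description. }
    exists f. split.
    + intros a b. apply (Huniq (a * b)); auto.
      destruct HR as (R1 & RM & RI). exact (RM _ _ (Hf a) (Hf b)).
    + intros h. destruct (gen_teval H e n h (Hsurj h)) as (t & Ht & <-).
      exists (teval G y t). apply (Huniq (teval G y t)); auto. now apply gen_pairing.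
Qed.
End Epimorphism.

Theorem mainTheorem5 (G H : Group) :
  fin_gen G -> nilpotent G ->
  (forall x, center G x -> isolator G (derived G) x) ->
  fin_gen H -> elem_equiv G H ->
  group_iso G H.
Proof.
  intros Gfg Gnil GZ Hfg EH.
  assert (EH' : elem_equiv H G) by (intros s Hs; symmetry; now apply EH).
  destruct (exists_epimorphism G H Gfg Gnil GZ Hfg EH) as (f & Hf & Sf).
  destruct (exists_epimorphism H G Hfg (transfer_nilpotent G H Gnil EH)
    (transfer_isolator G H Gfg Gnil GZ EH) Gfg EH') as (g & Hg & Sg).
  (* The composite of the two epimorphisms is a surjective endomorphism of the Noetherian group G,
     hence injective, and so is f. *)
  assert (Hinj : forall x, f x = 1 -> x = 1).
  { intros x Hx. apply (hopfian (fun x => g (f x))).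
    - now apply fg_nilpotent_noeth.
    - intros a b. now rewrite Hf, Hg.
    - intros z. destruct (Sg z) as [h <-]. destruct (Sf h) as [a <-]. eauto.
    - rewrite Hx. now apply hom1. }
  set (f' := fun h => proj1_sig (constructive_indefinite_description _ (Sf h))).
  assert (Hf' : forall h, f (f' h) = h).
  { intros h. unfold f'. now destruct constructive_indefinite_description. }
  exists f, f'. split; [exact Hf | split; [|exact Hf']]. intros x.
  assert (E : x^-1 * f' (f x) = 1).
  { apply Hinj. rewrite Hf, Hf', homV by auto. apply mulVg. }
  apply inv_uniq in E. now rewrite invK in E.
Qed.
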